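(* Let $N\ge 2$, let $q\in\mathbb{C}^*$ be not a root of unity, with a fixed square root $q^{1/2}$. Let $z_1,\dots,z_L\in\mathbb{C}^*$ generate pairwise disjoint lattices $q^{\mathbb{Z}}z_m$, and let $\lambda_m=\sum_{i=1}^{N-1} l_m^i\omega_i$ ($m=1,\dots,L$) be dominant integral weights of $\mathrm{SL}(N)$; put $\ell_m^k=\sum_{j=1}^k l_m^j$ and $\ell_m^0=0$. Let $\kappa_1,\dots,\kappa_N\in\mathbb{C}^*$ with $\prod_i\kappa_i=1$, and suppose that $\kappa_1,\dots,\kappa_N$ generate pairwise disjoint lattices $q^{\mathbb{Z}}\kappa_i$. Put $\zeta_k=\kappa_{N+1-k}$ for $k=1,\dots,N$ and $Z=\mathrm{diag}(\zeta_1,\dots,\zeta_N)$. Then there is a one-to-one correspondence between nondegenerate solutions $\{u_{k,a}\}$ ($k=1,\dots,N-1$, $a=1,\dots,r_k$) of the $\mathfrak{sl}_N$ XXZ Bethe ansatz equations $$\frac{\kappa_{k+1}}{\kappa_{k}}\prod_{s=1}^L\frac{q^{\ell_s^{k}+\frac{k}{2}-\frac{3}{2}}u_{k,a}-z_s}{q^{\ell_s^{k-1}+\frac{k}{2}-\frac{3}{2}}u_{k,a}-z_s}\cdot\prod_{c=1}^{r_{k-1}}\frac{q^{\frac12}u_{k,a}-u_{k-1,c}}{q^{-\frac12}u_{k,a}-u_{k-1,c}}\cdot\prod_{b=1}^{r_k}\frac{q^{-1}u_{k,a}-u_{k,b}}{q\,u_{k,a}-u_{k,b}}\cdot\prod_{d=1}^{r_{k+1}}\frac{q^{\frac12}u_{k,a}-u_{k+1,d}}{q^{-\frac12}u_{k,a}-u_{k+1,d}}=-1$$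 (for $k=1,\dots,N-1$, $a=1,\dots,r_k$, with $r_0=r_N=0$) and nondegenerate $Z$-twisted $(\mathrm{SL}(N),q)$-opers with regular singularities at $z_1,\dots,z_L$ with weights $\lambda_1,\dots,\lambda_L$. The correspondence is given by $$v_{k,a}=q^{\frac{1-k}{2}}u_{k,a},$$ where the $v_{k,a}$ are the roots of the polynomials $\mathcal{V}_k(z)=\prod_{a=1}^{r_k}(z-v_{k,a})$ attached to the $q$-oper. Moreover, the $q$-oper equations $$\det\left[\zeta_{N-k+i}^{\,j-1}\,s_{N-k+i}(q^{j-1}z)\right]_{1\le i,j\le k}=\alpha_k W_k(z)\mathcal{V}_k(z),\qquad k=1,\dots,N,$$ become identical to the Bethe equations if one normalizes the section $s=(s_1,\dots,s_N)$ so that $\alpha_k=q^{\frac{k-1}{2}r_k}\det V(\kappa_k,\dots,\kappa_1)$; that is, for nondegenerate $\{u_{k,a}\}$ and $v_{k,a}=q^{(1-k)/2}u_{k,a}$, the Bethe equations hold if and only if there are polynomials $s_1,\dots,s_N$ satisfying these determinant equations with these $\alpha_k$.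
   Context: All bundles on $\mathbb{P}^1$ are trivializable. For a vector bundle $E$ on $\mathbb{P}^1$, $E^q$ denotes its pullback under $z\mapsto qz$. A (meromorphic) $(\mathrm{GL}(N),q)$-connection is a pair $(E,A)$ with $E$ of rank $N$ and $A$ a meromorphic section of $\mathrm{Hom}(E,E^q)$ whose matrix $A(z)$ in a trivialization lies in $\mathrm{GL}(N,\mathbb{C}(z))$; it is an $(\mathrm{SL}(N),q)$-connection if $\det A(z)=1$ in some trivialization. Changing the trivialization by $g(z)$ replaces $A(z)$ by $g(qz)A(z)g(z)^{-1}$ ($q$-gauge change). An $(\mathrm{SL}(N),q)$-oper with regular singularities at $z_1,\dots,z_L$ of weights $\lambda_1,\dots,\lambda_L$ is a triple $(E,A,\mathcal{L}_\bullet)$, where $(E,A)$ is an $(\mathrm{SL}(N),q)$-connection and $\mathcal{L}_\bullet$ is a complete flag of subbundles of $E$ such that $A$ maps $\mathcal{L}_i$ into $\mathcal{L}_{i+1}^q$ and each induced map $\bar A_i:\mathcal{L}_i/\mathcal{L}_{i-1}\to\mathcal{L}_{i+1}^q/\mathcal{L}_i^q$ ($i=1,\dots,N-1$) is an isomorphism on $\mathbb{P}^1\setminus\{\infty\}$ except at the points $q^{-\ell_m^{i-1}}z_m,q^{-\ell_m^{i-1}-1}z_m,\dots,q^{-\ell_m^i+1}z_m$ for each $m$, where it has simple zeros. It is $Z$-twisted if $A$ is $q$-gauge equivalent to the constant matrix $Z^{-1}$. $q$-opers are considered up to isomorphism. Set $\Lambda_i(z)=\prod_{m=1}^L\prod_{j=\ell_m^{i-1}}^{\ell_m^i-1}(z-q^{-j}z_m)$,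 $P_i=\Lambda_1\Lambda_2\cdots\Lambda_i$, and $W_k(z)=P_1(z)\,P_2(qz)\,P_3(q^2z)\cdots P_{k-1}(q^{k-2}z)$ (so $W_1=1$). Given a $Z$-twisted $q$-oper, choose a trivialization in which $A=Z^{-1}$, and let $s(z)=(s_1(z),\dots,s_N(z))$, with polynomial components, be a section generating $\mathcal{L}_1$ over $\mathbb{P}^1\setminus\{\infty\}$. The $q$-oper is called nondegenerate if its associated Miura $q$-oper, with preserved flag the standard flag of the ordered basis $e_1,\dots,e_N$, is nondegenerate. Explicitly, this means that there are nonzero constants $\alpha_k$ and monic polynomials $\mathcal{V}_k(z)=\prod_{a=1}^{r_k}(z-v_{k,a})$, $k=1,\dots,N$, with $\mathcal{V}_N=1$, such that $$\det\left[\zeta_{N-k+i}^{\,j-1}s_{N-k+i}(q^{j-1}z)\right]_{1\le i,j\le k}=\alpha_kW_k(z)\mathcal{V}_k(z),\qquad k=1,\dots,N,$$ and each lattice $q^{\mathbb{Z}}v_{k,a}$ is disjoint from $q^{\mathbb{Z}}v_{i,b}$ for every $(i,b)\ne(k,a)$ and from every $q^{\mathbb{Z}}z_m$. (The left side is the coefficient of $e_1\wedge\dots\wedge e_{N-k}\wedge s(z)\wedge Zs(qz)\wedge\dots\wedge Z^{k-1}s(q^{k-1}z)$.) The constants $\alpha_k$ can be prescribed arbitrarily by rescaling $s$ and applying constant diagonal gauge changes. The nonnegative integers $r_1,\dots,r_{N-1}$ are arbitrary. A solution of the Bethe equations is considered up to permuting the $u_{k,1},\dots,u_{k,r_k}$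 for each $k$, and all denominators are required to be nonzero. It is nondegenerate if $z_s\notin q^{\frac{1-k}{2}}q^{\mathbb{Z}}u_{k,a}$ for all $s,k,a$, and $u_{k,a}\notin q^{\frac{k-k'}{2}}q^{\mathbb{Z}}u_{k',a'}$ unless $k=k'$ and $a=a'$. $V(\gamma_1,\dots,\gamma_k)$ is the $k\times k$ Vandermonde matrix with $(i,j)$ entry $\gamma_i^{j-1}$. *)

(* Defs.v *)
From HB Require Import structures.
From mathcomp Require Import all_boot all_order all_algebra.
From mathcomp Require Import generic_quotient fraction complex reals.

Set Implicit Arguments.
Unset Strict Implicit.
Unset Printing Implicit Defensive.

Import GRing.Theory.
Local Open Scope ring_scope.
Local Open Scope quotient_scope.

(* Families such as kappa, zeta, s, u, v and the flag L are functions on nat,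
   indexed from 1 (the flag from 0); only the values in the relevant range
   ([1, N], [1, N-1] or [0, N]) are ever used.  Half-integral powers of q are
   integral powers of the fixed square root qh: q^(n/2) = qh ^ n. *)

Definition not_root_of_unity (C : fieldType) (q : C) : Prop :=
  forall n : nat, (0 < n)%N -> q ^+ n != 1.

Definition disjoint_lattices (C : fieldType) (q x y : C) : Prop :=
  forall m n : int, q ^ m * x != q ^ n * y.

Definition dilate (C : fieldType) (c : C) (p : {poly C}) : {poly C} :=
  p \Po (c *: 'X).

Notation ratfun C := {fraction {poly C}}.

(* f(z) |-> f(q z) on C(z), for q != 0; see qpull_frac. *)
Definition qpull (C : fieldType) (q : C) (f : ratfun C) : ratfun C :=
  FracField.tofrac (dilate q \n_(repr f)) /
  FracField.tofrac (dilate q \d_(repr f)).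

Lemma dilate_eq0 (C : fieldType) (q : C) (p : {poly C}) :
  q != 0 -> (dilate q p == 0) = (p == 0).
Proof.
by move=> q0; rewrite -!size_poly_eq0 size_comp_poly2 // size_scale // size_polyX.
Qed.

Lemma frac_numden (T : idomainType) (x : {ratio T}) :
  \pi_({fraction T}) x = FracField.tofrac \n_x / FracField.tofrac \d_x.
Proof.
rewrite -[LHS](mulr1) -(@mulfV _ (FracField.tofrac \d_x)); last first.
  by rewrite tofrac_eq0 denom_ratioP.
rewrite mulrA; congr (_ / _).
change (FracField.mul (\pi_(FracField.type T) x) (FracField.tofrac \d_x)
        = FracField.tofrac \n_x).
rewrite !piE; apply/eqmodP; rewrite /= FracField.equivfE /FracField.mulf.
by rewrite !numden_Ratio ?mulf_neq0 ?oner_eq0 ?denom_ratioP // !mulr1 mulrC.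
Qed.

Lemma qpull_frac (C : fieldType) (q : C) (n d : {poly C}) :
  q != 0 -> d != 0 ->
  qpull q (FracField.tofrac n / FracField.tofrac d) =
  FracField.tofrac (dilate q n) / FracField.tofrac (dilate q d).
Proof.
move=> q0 d0; set f := (X in qpull q X); rewrite /qpull.
have fE : f = FracField.tofrac \n_(repr f) / FracField.tofrac \d_(repr f).
  by rewrite -frac_numden reprK.
have d'0 : \d_(repr f) != 0 := denom_ratioP _.
have E : FracField.tofrac (n * \d_(repr f)) =
         FracField.tofrac (\n_(repr f) * d).
  by apply/eqP; rewrite !tofracM -eqr_div ?tofrac_eq0 // -fE.
apply/eqP; rewrite eqr_div ?tofrac_eq0 ?dilate_eq0 // -!tofracM.
move/eqP: E; rewrite tofrac_eq => /eqP E.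
by rewrite /dilate -!comp_polyM E.
Qed.

Definition polmx (C : fieldType) (m n : nat) (M : 'M[{poly C}]_(m, n)) :
  'M[ratfun C]_(m, n) := map_mx (@FracField.tofrac {poly C}) M.

Definition cstmx (C : fieldType) (m n : nat) (M : 'M[C]_(m, n)) :
  'M[ratfun C]_(m, n) := polmx (map_mx polyC M).

Definition ell (L : nat) (l : 'I_L -> nat -> nat) (m : 'I_L) (k : nat) : nat :=
  \sum_(1 <= j < k.+1) l m j.

Definition Lambda (C : fieldType) (q : C) (L : nat) (z : 'I_L -> C)
    (l : 'I_L -> nat -> nat) (i : nat) : {poly C} :=
  \prod_(m < L) \prod_(ell l m i.-1 <= j < ell l m i) ('X - (q ^- j * z m)%:P).

Definition Ppoly (C : fieldType) (q : C) (L : nat) (z : 'I_L -> C)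
    (l : 'I_L -> nat -> nat) (i : nat) : {poly C} :=
  \prod_(1 <= j < i.+1) Lambda q z l j.

Definition Wpoly (C : fieldType) (q : C) (L : nat) (z : 'I_L -> C)
    (l : 'I_L -> nat -> nat) (k : nat) : {poly C} :=
  \prod_(1 <= j < k) dilate (q ^+ j.-1) (Ppoly q z l j).

(* A family u = (u_{k,a}), 1 <= k <= N-1, 1 <= a <= r_k, is given by the lists
   u k of length r_k.  The truncation encodes r_0 = r_N = 0. *)
Definition level (C : fieldType) (N : nat) (u : nat -> seq C) (k : nat) :
  seq C := if (0 < k < N)%N then u k else [::].

Definition same_up_to_perm (C : fieldType) (N : nat) (u u' : nat -> seq C) :
  Prop := forall k : nat, (0 < k < N)%N -> perm_eq (u k) (u' k).

(* v_{k,a} = q^((1-k)/2) u_{k,a} *)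
Definition rescale (C : fieldType) (qh : C) (u : nat -> seq C) :
  nat -> seq C := fun k => [seq qh ^ (1 - k%:Z) * x | x <- u k].

(* For k = N this is 1. *)
Definition Vpoly (C : fieldType) (N : nat) (v : nat -> seq C) (k : nat) :
  {poly C} := \prod_(x <- level N v k) ('X - x%:P).

Definition bethe_lhs (C : fieldType) (q qh : C) (N L : nat) (z : 'I_L -> C)
    (l : 'I_L -> nat -> nat) (kappa : nat -> C) (u : nat -> seq C)
    (k : nat) (x : C) : C :=
  kappa k.+1 / kappa k
  * \prod_(m < L)
      ((qh ^ ((2 * ell l m k + k)%N%:Z - 3) * x - z m)
       / (qh ^ ((2 * ell l m k.-1 + k)%N%:Z - 3) * x - z m))
  * \prod_(c <- level N u k.-1) ((qh * x - c) / (qh^-1 * x - c))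
  * \prod_(b <- level N u k) ((q^-1 * x - b) / (q * x - b))
  * \prod_(d <- level N u k.+1) ((qh * x - d) / (qh^-1 * x - d)).

Definition bethe_denominators_neq0 (C : fieldType) (q qh : C) (N L : nat)
    (z : 'I_L -> C) (l : 'I_L -> nat -> nat) (u : nat -> seq C)
    (k : nat) (x : C) : Prop :=
  [/\ forall m : 'I_L,
        qh ^ ((2 * ell l m k.-1 + k)%N%:Z - 3) * x - z m != 0,
      forall c : C, c \in level N u k.-1 -> qh^-1 * x - c != 0,
      forall b : C, b \in level N u k -> q * x - b != 0 &
      forall d : C, d \in level N u k.+1 -> qh^-1 * x - d != 0].

Definition bethe_solution (C : fieldType) (q qh : C) (N L : nat)
    (z : 'I_L -> C) (l : 'I_L -> nat -> nat) (kappa : nat -> C)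
    (u : nat -> seq C) : Prop :=
  forall (k : nat) (x : C), (0 < k < N)%N -> x \in u k ->
    bethe_denominators_neq0 q qh N z l u k x /\
    bethe_lhs q qh N z l kappa u k x = -1.

Definition bethe_nondegenerate (C : fieldType) (q qh : C) (N L : nat)
    (z : 'I_L -> C) (u : nat -> seq C) : Prop :=
  (forall (m : 'I_L) (k a : nat), (0 < k < N)%N -> (a < size (u k))%N ->
     forall n : int, z m != qh ^ (1 - k%:Z) * (q ^ n * nth 0 (u k) a)) /\
  (forall k a k' a' : nat,
     (0 < k < N)%N -> (a < size (u k))%N ->
     (0 < k' < N)%N -> (a' < size (u k'))%N ->
     (k, a) <> (k', a') ->
     forall n : int,
       nth 0 (u k) a != qh ^ (k%:Z - k'%:Z) * (q ^ n * nth 0 (u k') a')).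

(* A bundle E of rank N on P^1 is handled through a trivialization over
   P^1 \ {oo}, so that changes of trivialization and isomorphisms are elements
   g of GL_N(C[z]), and A is given by its matrix A(z).  A subbundle of E on P^1
   is determined by its generic fibre, and every subspace of C(z)^N is such a
   fibre: a flag of subbundles is a flag of subspaces of C(z)^N. *)
Record qflagged (C : fieldType) (N : nat) := QFlagged {
  qconn : 'M[ratfun C]_N;
  qflag : nat -> {vspace 'cV[ratfun C]_N} }.

Definition gauge (C : fieldType) (q : C) (N : nat) (g : 'M[{poly C}]_N)
    (A : 'M[ratfun C]_N) : 'M[ratfun C]_N :=
  map_mx (qpull q) (polmx g) *m A *m invmx (polmx g).

Definition gauge_equiv (C : fieldType) (q : C) (N : nat)
    (A A' : 'M[ratfun C]_N) : Prop :=
  exists2 g : 'M[{poly C}]_N, g \in unitmx & gauge q g A = A'.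

Definition qoper_iso (C : fieldType) (q : C) (N : nat) (O O' : qflagged C N) :
  Prop :=
  exists2 g : 'M[{poly C}]_N, g \in unitmx &
    gauge q g (qconn O) = qconn O' /\
    (forall i : nat, (i <= N)%N -> forall w : 'cV[ratfun C]_N,
       (polmx g *m w \in qflag O' i) = (w \in qflag O i)).

Definition SL_qconnection (C : fieldType) (q : C) (N : nat)
    (A : 'M[ratfun C]_N) : Prop :=
  A \in unitmx /\ exists2 A', gauge_equiv q A A' & \det A' = 1.

Definition complete_flag (C : fieldType) (N : nat)
    (U : nat -> {vspace 'cV[ratfun C]_N}) : Prop :=
  (forall i : nat, (i <= N)%N -> \dim (U i) = i) /\
  (forall i : nat, (i < N)%N -> (U i <= U i.+1)%VS).

(* w belongs to the pullback U^q of U under z |-> q z. *)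
Definition in_qpull (C : fieldType) (q : C) (N : nat)
    (U : {vspace 'cV[ratfun C]_N}) (w : 'cV[ratfun C]_N) : Prop :=
  exists2 w' : 'cV[ratfun C]_N, w' \in U & w = map_mx (qpull q) w'.

(* The polynomial vectors f_1, ..., f_N form a basis of C[z]^N adapted to the
   flag, so that f_i generates the line bundle L_i / L_(i-1) over P^1 \ {oo}.
   Such frames always exist, C[z] being principal, and f_i is unique modulo
   L_(i-1) up to a factor in C^*. *)
Definition flag_frame (C : fieldType) (N : nat)
    (U : nat -> {vspace 'cV[ratfun C]_N}) (f : nat -> 'cV[{poly C}]_N) : Prop :=
  (\matrix_(i < N, j < N) f j.+1 i 0) \in unitmx /\
  (forall i : nat, (0 < i <= N)%N -> polmx (f i) \in U i).

Definition singular_point (C : fieldType) (q : C) (L : nat) (z : 'I_L -> C)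
    (l : 'I_L -> nat -> nat) (i : nat) (x : C) : Prop :=
  exists (m : 'I_L) (j : nat),
    (ell l m i.-1 <= j < ell l m i)%N /\ x = q ^- j * z m.

(* c is the matrix of A_i : L_i/L_(i-1) -> L_(i+1)^q/L_i^q with respect to the
   generators f_i(z) and f_(i+1)(q z). *)
Definition regular_singularities (C : fieldType) (q : C) (N L : nat)
    (z : 'I_L -> C) (l : 'I_L -> nat -> nat) (O : qflagged C N) : Prop :=
  exists2 f : nat -> 'cV[{poly C}]_N, flag_frame (qflag O) f &
    forall i : nat, (0 < i < N)%N ->
    exists c : {poly C},
      [/\ in_qpull q (qflag O i)
            (qconn O *m polmx (f i) -
             FracField.tofrac c *: map_mx (qpull q) (polmx (f i.+1))),
          forall x : C, singular_point q z l i x -> mup x c = 1%N &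
          forall x : C, ~ singular_point q z l i x -> ~~ root c x].

Definition SL_qoper (C : fieldType) (q : C) (N L : nat)
    (z : 'I_L -> C) (l : 'I_L -> nat -> nat) (O : qflagged C N) : Prop :=
  [/\ SL_qconnection q (qconn O),
      complete_flag (qflag O),
      forall i : nat, (0 < i < N)%N ->
        forall w : 'cV[ratfun C]_N, w \in qflag O i ->
          in_qpull q (qflag O i.+1) (qconn O *m w) &
      regular_singularities q z l O].

Definition zeta (C : fieldType) (N : nat) (kappa : nat -> C) (k : nat) : C :=
  kappa (N.+1 - k)%N.

Definition Zmx (C : fieldType) (N : nat) (kappa : nat -> C) : 'M[C]_N :=
  diag_mx (\row_(i < N) zeta N kappa i.+1).

Definition Z_twisted (C : fieldType) (q : C) (N : nat) (kappa : nat -> C)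
    (O : qflagged C N) : Prop :=
  gauge_equiv q (qconn O) (cstmx (invmx (Zmx N kappa))).

(* det [ zeta_(N-k+i)^(j-1) s_(N-k+i)(q^(j-1) z) ]_(1 <= i, j <= k), the
   matrix indices i, j being shifted to start from 0. *)
Definition qwronskian (C : fieldType) (q : C) (N : nat) (kappa : nat -> C)
    (s : nat -> {poly C}) (k : nat) : {poly C} :=
  \det (\matrix_(i < k, j < k)
          (zeta N kappa (N - k + i).+1 ^+ j
           *: dilate (q ^+ j) (s (N - k + i).+1))).

Definition qoper_equations (C : fieldType) (q : C) (N L : nat)
    (z : 'I_L -> C) (l : 'I_L -> nat -> nat) (kappa : nat -> C)
    (alpha : nat -> C) (s : nat -> {poly C}) (v : nat -> seq C) : Prop :=
  forall k : nat, (0 < k <= N)%N ->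
    qwronskian q N kappa s k = alpha k *: (Wpoly q z l k * Vpoly N v k).

(* s = (s_1, ..., s_N) generates, over P^1 \ {oo}, the line subbundle with
   generic fibre U. *)
Definition generating_section (C : fieldType) (N : nat)
    (U : {vspace 'cV[ratfun C]_N}) (s : nat -> {poly C}) : Prop :=
  \dim U = 1%N /\
  polmx (\col_(i < N) s i.+1) \in U /\
  forall x : C, exists2 i : nat, (0 < i <= N)%N & (s i).[x] != 0.

(* The polynomials with roots v k are attached to the Z-twisted q-oper O. *)
Definition attached_roots (C : fieldType) (q : C) (N L : nat)
    (z : 'I_L -> C) (l : 'I_L -> nat -> nat) (kappa : nat -> C)
    (O : qflagged C N) (v : nat -> seq C) : Prop :=
  exists (O' : qflagged C N) (s : nat -> {poly C}) (alpha : nat -> C),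
    [/\ qoper_iso q O O',
        qconn O' = cstmx (invmx (Zmx N kappa)),
        generating_section (qflag O' 1%N) s,
        forall k : nat, (0 < k <= N)%N -> alpha k != 0 &
        qoper_equations q N z l kappa alpha s v].

Definition roots_nondegenerate (C : fieldType) (q : C) (N L : nat)
    (z : 'I_L -> C) (v : nat -> seq C) : Prop :=
  (forall k a k' a' : nat,
     (0 < k < N)%N -> (a < size (v k))%N ->
     (0 < k' < N)%N -> (a' < size (v k'))%N ->
     (k, a) <> (k', a') ->
     disjoint_lattices q (nth 0 (v k) a) (nth 0 (v k') a')) /\
  (forall (k a : nat) (m : 'I_L), (0 < k < N)%N -> (a < size (v k))%N ->
     disjoint_lattices q (nth 0 (v k) a) (z m)).

Definition nondegenerate_twisted_qoper (C : fieldType) (q : C) (N L : nat)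
    (z : 'I_L -> C) (l : 'I_L -> nat -> nat) (kappa : nat -> C)
    (O : qflagged C N) : Prop :=
  [/\ SL_qoper q z l O,
      Z_twisted q kappa O &
      exists2 v : nat -> seq C,
        attached_roots q z l kappa O v & roots_nondegenerate q N z v].

(* alpha_k = q^((k-1) r_k / 2) det V(kappa_k, ..., kappa_1); the library's
   Vandermonde matrix is the transpose of V. *)
Definition bethe_alpha (C : fieldType) (qh : C) (N : nat) (kappa : nat -> C)
    (u : nat -> seq C) (k : nat) : C :=
  qh ^+ (k.-1 * size (level N u k))
  * \det (Vandermonde k (\row_(i < k) kappa (k - i)%N))^T.

(* The relation R is compatible with the equivalence relations eqA on PA and
   eqB on PB, and is the graph of a bijection between the quotients. *)
Definition one_to_one_correspondence (A B : Type) (PA : A -> Prop)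
    (eqA : A -> A -> Prop) (PB : B -> Prop) (eqB : B -> B -> Prop)
    (R : A -> B -> Prop) : Prop :=
  [/\ forall a : A, PA a -> exists2 b : B, PB b & R a b,
      forall b : B, PB b -> exists2 a : A, PA a & R a b,
      forall (a a' : A) (b b' : B), PA a -> PA a' -> PB b -> PB b' ->
        R a b -> R a' b' -> (eqA a a' <-> eqB b b') &
      forall (a a' : A) (b b' : B), PA a -> PA a' -> PB b -> PB b' ->
        eqA a a' -> eqB b b' -> R a b -> R a' b'].

(* Main.v *)
From HB Require Import structures.
Require Import Defs.
From mathcomp Require Import all_boot all_order all_algebra.
From mathcomp Require Import perm generic_quotient fraction.
From mathcomp Require Import boolp complex reals ring zify.

Set Implicit Arguments.
Unset Strict Implicit.
Unset Printing Implicit Defensive.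

Import GRing.Theory.
Local Open Scope ring_scope.

(** Number the sections backwards, t_p = s_(N+1-p), with twist kappa_p, and let
    F(p, m) be the q-Casorati determinant of t_p, t_(m-1), ..., t_1.  The k-th
    q-oper equation prescribes D_k = F(k, k) = alpha_k W_k V_k.  Condensation of
    determinants gives (casorati_rec)
      F(p, m+1)(z) D_(m-1)(qz)
        = kappa_m D_m(qz) F(p, m)(z) - kappa_p D_m(z) F(p, m)(qz),
    a first-order q-difference equation for F(p, m) whose coefficients are known.

    From the q-oper equations to the Bethe equations: for p = m + 1 the left
    side is prescribed as well.  At a root v of V_m and at v/q the right side
    involves the same unknown F(m+1, m)(v); eliminating it leaves the Bethe
    equation of v (casorati_bethe).

    From the Bethe equations to the q-oper equations: t_p is found by solving
    these equations for m = p - 1, ..., 1, from F(p, p) = D_p down to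
    F(p, 1) = t_p.  Each of them has a polynomial solution if and only if its
    right side satisfies one linear relation between its values at v and v/q,
    for every root v of V_m: interpolation at the roots removes the poles, and
    what is left is solved coefficient by coefficient, because kappa_m is never
    q^n kappa_p (qdiff_solve).  The required relation follows from the Bethe
    equation of v together with the difference equation solved one step earlier
    (ladder_step).  The construction also shows that W_m divides every F(p, m),
    and comparing leading coefficients shows that the V_k determine the t_p up
    to constant factors (qoper_sections_unique).

    From sections to q-opers: when A = Z^-1, the flag is forced to be
    L_k = span (s(z), Z^-1 s(z/q), ..., Z^-(k-1) s(z/q^(k-1)))
    (flag_from_section), so the point is that this flag has exactly the
    prescribed zeros.  Over C[z] the matrix of these vectors is B H with B
    unimodular and H upper triangular (hermite_form).  The columns of B are a
    frame adapted to the flag, in which Z^-1 has a Hessenberg matrix with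
    subdiagonal entries c_m(z) = d_(m+1)(qz) / d_m(z), where the d_m are the
    diagonal entries of H.  As W_m divides the minors F(p, m) and is prime to
    V_(m-1)(qz), the quotient W_m(z) / W_(m-1)(qz) divides d_m(q^(m-1) z); the
    degree of the full determinant D_N leaves no room for more, so the two agree
    up to a constant and c_m is a multiple of Lambda_m (frame_conn_Lambda).

    Finally, an isomorphism between two q-opers with A = Z^-1 is a constant
    diagonal matrix (gauge_Zinv), so isomorphism classes are sections up to
    constant factors on the components, and these are classified by the V_k. *)

(** * Determinants and condensation *)

(** Multiply M by its adjugate with the last n columns replaced by those of the
    identity: the product is block triangular. *)
Lemma det_ulsubmx_adj_regular (R : idomainType) (m n : nat) (M : 'M[R]_(m + n)) :
  \det M != 0 ->
  \det M * \det (ulsubmx (\adj M)) = \det M ^+ m * \det (drsubmx M).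
Proof.
move=> M0; set A := \adj M.
have E : M *m block_mx (ulsubmx A) 0 (dlsubmx A) 1%:M =
   block_mx (\det M)%:M (ursubmx M) 0 (drsubmx M).
  have : M *m A = (\det M)%:M := mul_mx_adj M.
  rewrite -{1 2}(submxK M) -{1}(submxK A) mulmx_block scalar_mx_block.
  move/eq_block_mx => [e1 _ e3 _].
  by rewrite -{1}(submxK M) mulmx_block e1 e3 !mulmx0 !mulmx1 !add0r submxK.
move/(congr1 determinant): E.
by rewrite det_mulmx det_lblock det_ublock det1 mulr1 det_scalar.
Qed.

(** For singular M, the identity is proved for M + X over the polynomial ring,
    whose determinant is monic, and evaluated at X = 0. *)
Lemma desnanot_jacobi (R : idomainType) (n : nat) (M : 'M[R]_(2 + n)) :
  \det (ulsubmx (\adj M)) = \det M * \det (drsubmx M).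
Proof.
pose P := char_poly_mx (- M).
have Pdet : \det P != 0 by rewrite -/(char_poly _) monic_neq0 ?char_poly_monic.
have key : \det (ulsubmx (\adj P)) = \det P * \det (drsubmx P).
  apply: (mulfI Pdet); rewrite det_ulsubmx_adj_regular // expr2 mulrA //.
have ev : map_mx (horner_eval 0) P = M.
  apply/matrixP=> i j; rewrite !mxE /horner_eval !(hornerE, mxE).
  by rewrite hornerMn hornerX mul0rn sub0r opprK.
move/(congr1 (horner_eval (0 : R))): key; rewrite rmorphM /=.
rewrite -!det_map_mx ev.
have sub (B : 'M[{poly R}]_(2 + n)) :
    map_mx (horner_eval 0) (ulsubmx B) = ulsubmx (map_mx (horner_eval (0 : R)) B)
    /\ map_mx (horner_eval 0) (drsubmx B) = drsubmx (map_mx (horner_eval (0 : R)) B).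
  by split; apply/matrixP=> i j; rewrite !mxE.
by rewrite (sub _).1 (sub _).2 map_mx_adj ev.
Qed.

(** Entries are indexed by natural numbers, so that deleting rows and columns
    only changes the index functions and never the types. *)
Definition lminor (R : pzRingType) (n : nat) (f : nat -> nat -> R) : R :=
  \det (\matrix_(i < n, j < n) f i j).

Lemma eq_lminor (R : pzRingType) (n : nat) (f g : nat -> nat -> R) :
  (forall i j, (i < n)%N -> (j < n)%N -> f i j = g i j) ->
  lminor n f = lminor n g.
Proof. by move=> fg; congr (\det _); apply/matrixP=> i j; rewrite !mxE fg. Qed.

Lemma lminor_rmorph (R S : comNzRingType) (h : {rmorphism R -> S}) (n : nat)
    (f : nat -> nat -> R) :
  h (lminor n f) = lminor n (fun i j => h (f i j)).
Proof. by rewrite -det_map_mx; congr (\det _); apply/matrixP=> i j; rewrite !mxE. Qed.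

Lemma lminor_scale_rows (R : comNzRingType) (n : nat) (a : nat -> R)
    (f : nat -> nat -> R) :
  lminor n (fun i j => a i * f i j) = \prod_(i < n) a i * lminor n f.
Proof.
rewrite /lminor; set A := \matrix_(i, j) f i j.
have -> : \matrix_(i < n, j < n) (a i * f i j) = diag_mx (\row_i a i) *m A.
  by rewrite mul_diag_mx; apply/matrixP=> i j; rewrite !mxE.
by rewrite det_mulmx det_diag; congr (_ * _); apply: eq_bigr=> i _; rewrite mxE.
Qed.

Lemma lminor_eq_rows (R : comNzRingType) (n : nat) (f : nat -> nat -> R)
    (i1 i2 : nat) :
  (i1 < n)%N -> (i2 < n)%N -> i1 != i2 -> f i1 =1 f i2 -> lminor n f = 0.
Proof.
move=> h1 h2 ne e; apply: (@determinant_alternate _ _ _ (Ordinal h1) (Ordinal h2)) => //.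
by move=> j; rewrite !mxE /= e.
Qed.

Lemma det_row_col' (R : comNzRingType) (n : nat) (f : nat -> nat -> R) (i0 j0 : 'I_n.+1) :
  \det (row' i0 (col' j0 (\matrix_(i < n.+1, j < n.+1) f i j))) =
  lminor n (fun i j => f (bump i0 i) (bump j0 j)).
Proof. by congr (\det _); apply/matrixP=> i j; rewrite !mxE. Qed.

Definition last_first (n j : nat) : nat := if j is j'.+1 then j' else n.

Lemma lminor_last_first (R : comNzRingType) (n : nat) (f : nat -> nat -> R) :
  lminor n.+1 (fun i j => f i (last_first n j)) = (-1) ^+ n * lminor n.+1 f.
Proof.
rewrite /lminor (expand_det_col _ ord0) (expand_det_col (\matrix_(i, j) f i j) ord_max).
rewrite mulr_sumr; apply: eq_bigr => i _.
rewrite !mxE /= /cofactor.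
rewrite (det_row_col' (fun i j => f i (last_first n j))) (det_row_col' f).
rewrite addn0 exprD.
have -> : lminor n (fun a b => f (bump i a) (bump n b)) =
    lminor n (fun a b => f (bump i a) (last_first n (bump 0 b))).
  by apply: eq_lminor => a b _ bn; rewrite /bump (leqNgt n) bn.
have sq : (-1) ^+ n * (-1) ^+ n = 1 :> R by rewrite -expr2 sqrr_sign.
by ring: sq.
Qed.

(** The rows 0 and 1 and the first and last columns play the special part. The
    Desnanot-Jacobi identity is applied with the columns listed as
    0, n + 1, 1, ..., n, so that its four minors fill the upper left block of the
    adjugate; this reordering has sign (-1)^n, which occurs once on each side. *)
Lemma lminor_condensation (R : idomainType) (n : nat) (f : nat -> nat -> R) :
  lminor n.+2 f * lminor n (fun i j => f i.+2 j.+1) =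
  lminor n.+1 (fun i j => f i.+1 j.+1) * lminor n.+1 (fun i j => f (bump 1 i) j) -
  lminor n.+1 (fun i j => f i.+1 j) * lminor n.+1 (fun i j => f (bump 1 i) j.+1).
Proof.
pose c j := if j is j'.+1 then (last_first n j').+1 else 0%N.
pose g i j := f i (c j).
pose M : 'M[R]_(2 + n) := \matrix_(i < n.+2, j < n.+2) g i j.
have cS j : c (bump 1 j) = j by case: j => [|j].
have detM : \det M = (-1) ^+ n * lminor n.+2 f.
  rewrite /lminor (expand_det_col _ ord0).
  rewrite (expand_det_col (\matrix_(i, j) f i j) ord0) mulr_sumr.
  apply: eq_bigr => i _; rewrite !mxE /= /cofactor (det_row_col' g).
  rewrite (det_row_col' f) addn0 /g /=.
  by rewrite (lminor_last_first n (fun a b => f (bump i a) b.+1)); ring.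
have drM : \det (drsubmx M) = lminor n (fun i j => f i.+2 j.+1).
  by congr (\det _); apply/matrixP=> i j; rewrite !mxE.
have adjM : \det (ulsubmx (\adj M)) =
    cofactor M ord0 ord0 * cofactor M (lift ord0 ord0) (lift ord0 ord0) -
    cofactor M (lift ord0 ord0) ord0 * cofactor M ord0 (lift ord0 ord0).
  have l0 : lshift n (ord0 : 'I_2) = ord0 by apply: val_inj.
  have l1 : lshift n (lift ord0 (ord0 : 'I_1)) = lift ord0 ord0 by apply: val_inj.
  have l1' : lshift n (lift (lift ord0 ord0) (0 : 'I_1)) = ord0 by apply: val_inj.
  rewrite (expand_det_row _ ord0) !big_ord_recl big_ord0 addr0.
  rewrite !mxE [X in _ * X + _]/cofactor [X in _ + _ * X]/cofactor !det_mx11 !mxE.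
  by rewrite l0 l1 l1' /=; ring.
have := desnanot_jacobi M.
rewrite adjM detM drM /cofactor !(det_row_col' g) /g.
have e1 h : lminor n.+1 (fun i j => f (h i) (c (bump ord0 j))) =
    (-1) ^+ n * lminor n.+1 (fun i j => f (h i) j.+1).
  exact: (lminor_last_first n (fun a b => f (h a) b.+1)).
have e2 h : lminor n.+1 (fun i j => f (h i) (c (bump (lift ord0 (ord0 : 'I_n.+1)) j))) =
    lminor n.+1 (fun i j => f (h i) j).
  by apply: eq_lminor => a b _ _; rewrite cS.
rewrite !e1 !e2 /= => e.
have sg : (-1) ^+ n != 0 :> R by rewrite signr_eq0.
by apply: (mulfI sg); rewrite mulrA -e; ring.
Qed.

(** * Dilations and q-Casorati determinants *)

HB.instance Definition _ (C : fieldType) (c : C) :=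
  GRing.LRMorphism.copy (@dilate C c) (comp_poly (c *: 'X)).

Section Dilate.
Variable C : fieldType.
Implicit Types (c x : C) (p r : {poly C}).

Lemma coef_dilate c p n : (dilate c p)`_n = c ^+ n * p`_n.
Proof.
rewrite /dilate comp_polyE coef_sum.
have E i : (p`_i *: (c *: 'X) ^+ i)`_n = (n == i)%:R * (c ^+ n * p`_n).
  rewrite exprZn scalerA coefZ coefXn.
  by case: eqP => [->|_]; rewrite ?mul0r ?mulr0 // mulr1 mul1r mulrC.
under eq_bigr => i _ do rewrite E.
have [lt|ge] := ltnP n (size p).
  rewrite (bigD1 (Ordinal lt)) //= eqxx mul1r big1 ?addr0 // => i ne.
  by rewrite [_ == _](_ : _ = false) ?mul0r //; apply: contraNF ne => /eqP ni; apply/eqP/val_inj.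
by rewrite (nth_default _ ge) mulr0 big1 // => i _; rewrite mulr0.
Qed.

Lemma horner_dilate c p x : (dilate c p).[x] = p.[c * x].
Proof. by rewrite /dilate horner_comp hornerZ hornerX. Qed.

Lemma dilateM c d p : dilate c (dilate d p) = dilate (c * d) p.
Proof. by apply/polyP=> n; rewrite !coef_dilate exprMn mulrA. Qed.

Lemma dilate1 p : dilate 1 p = p.
Proof. by apply/polyP=> n; rewrite coef_dilate expr1n mul1r. Qed.

Lemma dilateC c x : dilate c x%:P = x%:P.
Proof. exact: comp_polyC. Qed.

Lemma size_dilate c p : c != 0 -> size (dilate c p) = size p.
Proof. by move=> c0; rewrite /dilate size_comp_poly2 // size_scale // size_polyX. Qed.

Lemma lead_coef_dilate c p :
  c != 0 -> lead_coef (dilate c p) = c ^+ (size p).-1 * lead_coef p.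
Proof. by move=> c0; rewrite lead_coefE size_dilate // coef_dilate. Qed.

Lemma dilateZ c a p : dilate c (a *: p) = a *: dilate c p.
Proof. exact: linearZ. Qed.

Lemma dilate_inj c : c != 0 -> injective (dilate c).
Proof.
move=> c0 p r /(congr1 (dilate c^-1)).
by rewrite !dilateM mulVf // !dilate1.
Qed.
End Dilate.

Section Casorati.
Variables (C : fieldType) (q : C) (kap : nat -> C).

Definition qentry (t : nat -> {poly C}) (p j : nat) : {poly C} :=
  kap p ^+ j *: dilate (q ^+ j) (t p).

(** The rows of F(p, m) are t_p, t_(m-1), ..., t_1. *)
Definition qrow (p m i : nat) : nat := if i is 0%N then p else (m - i)%N.

Definition casorati (t : nat -> {poly C}) (p m : nat) : {poly C} :=
  lminor m (fun i j => qentry t (qrow p m i) j).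

Lemma qentryS t p j : qentry t p j.+1 = (kap p)%:P * dilate q (qentry t p j).
Proof.
rewrite /qentry linearZ /= dilateM exprS -scalerA mul_polyC exprS.
by [].
Qed.

Lemma eq_casorati t t' p m :
  (0 < m)%N -> t p = t' p -> (forall i, (0 < i < m)%N -> t i = t' i) ->
  casorati t p m = casorati t' p m.
Proof.
move=> m0 tp ti; apply: eq_lminor => i j im _; rewrite /qentry.
by case: i im => [|i] im /=; rewrite ?tp // ti //; lia.
Qed.

Lemma casorati0 t p : casorati t p 0 = 1.
Proof. exact: det_mx00. Qed.

Lemma casorati1 t p : casorati t p 1 = t p.
Proof. by rewrite /casorati /lminor det_mx11 mxE /qentry /= !expr0 scale1r dilate1. Qed.

(** For p < m the row t_p occurs twice. *)
Lemma casorati_repeated t p m : (0 < p < m)%N -> casorati t p m = 0.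
Proof.
move=> pm; apply: (@lminor_eq_rows _ m _ 0%N (m - p)%N); try lia.
by move=> j; congr (qentry _ _ _); rewrite /qrow; case E : (m - p)%N => [|k]; lia.
Qed.

Lemma lminor_qentryS t (r : nat -> nat) n :
  lminor n (fun i j => qentry t (r i) j.+1) =
  (\prod_(i < n) kap (r i))%:P * dilate q (lminor n (fun i j => qentry t (r i) j)).
Proof.
rewrite lminor_rmorph rmorph_prod /= -(lminor_scale_rows n (fun i => (kap (r i))%:P)).
by apply: eq_lminor => i j _ _; rewrite qentryS.
Qed.

(** Condensation with t_p and t_(m+1) as special rows: shifting all columns by
    one dilates a determinant and multiplies it by the twists of its rows, and
    the twists of the common rows t_m, ..., t_1 cancel. *)
Lemma casorati_rec t p m :
  (forall i, (0 < i <= m)%N -> kap i != 0) ->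
  casorati t p m.+2 * dilate q (casorati t m m) =
  kap m.+1 *: (dilate q (casorati t m.+1 m.+1) * casorati t p m.+1) -
  kap p *: (casorati t m.+1 m.+1 * dilate q (casorati t p m.+1)).
Proof.
move=> kap0.
have := lminor_condensation m (fun i j => qentry t (qrow p m.+2 i) j).
have rest : forall f, lminor m (fun i j => qentry t (qrow p m.+2 i.+2) (f j)) =
    lminor m (fun i j => qentry t (qrow m m i) (f j)).
  move=> f; apply: eq_lminor => i j _ _; congr (qentry _ _ _).
  by rewrite /qrow /bump; case: i => [|i] //=; lia.
have b_rest : forall f, lminor m.+1 (fun i j => qentry t (qrow p m.+2 i.+1) (f j)) =
    lminor m.+1 (fun i j => qentry t (qrow m.+1 m.+1 i) (f j)).
  move=> f; apply: eq_lminor => i j _ _; congr (qentry _ _ _).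
  by rewrite /qrow /bump; case: i => [|i] //=; lia.
have a_rest : forall f, lminor m.+1 (fun i j => qentry t (qrow p m.+2 (bump 1 i)) (f j)) =
    lminor m.+1 (fun i j => qentry t (qrow p m.+1 i) (f j)).
  move=> f; apply: eq_lminor => i j _ _; congr (qentry _ _ _).
  by rewrite /qrow /bump; case: i => [|i] //=; lia.
rewrite (rest S) (b_rest S) (b_rest id) (a_rest S) (a_rest id).
rewrite !lminor_qentryS -/(casorati t p m.+1) -/(casorati t p m.+2).
rewrite -/(casorati t m m) -/(casorati t m.+1 m.+1).
rewrite !big_ord_recl /=.
have -> : \prod_(i < m) kap (m - i)%N = \prod_(i < m) kap (m.+1 - bump 0 i)%N.
  by [].
have Pm : \prod_(i < m) kap (qrow m m i) = \prod_(i < m) kap (m.+1 - bump 0 i)%N.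
  by apply: eq_bigr => i _; congr kap; rewrite /qrow /bump; case: (nat_of_ord i) => [|k]; lia.
rewrite Pm; set P := \prod_(i < m) _.
have P0 : P%:P != 0.
  rewrite polyC_eq0; apply/prodf_neq0 => i _; apply: kap0.
  by rewrite /bump; have := ltn_ord i; lia.
rewrite !rmorphM /= => e; apply: (mulfI P0); rewrite mulrCA e -!mul_polyC.
by ring.
Qed.
End Casorati.

(** * First-order q-difference equations for polynomials *)

Section FirstOrder.
Variables (C : fieldType) (q : C).
Hypothesis q0 : q != 0.

Lemma interpolation (s : seq C) (f : C -> C) :
  uniq s -> exists p : {poly C}, forall x, x \in s -> p.[x] = f x.
Proof.
elim: s => [|a s IH] /=; first by exists 0.
case/andP=> ans /IH[p pf].
pose V := \prod_(y <- s) ('X - y%:P).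
have Va : V.[a] != 0 by rewrite -/(root V a) root_prod_XsubC.
exists (p + ((f a - p.[a]) / V.[a]) *: V) => x; rewrite inE => /predU1P[->|xs].
  by rewrite !hornerE mulfVK // addrC subrK.
have /rootP Vx : root V x by rewrite root_prod_XsubC.
by rewrite !hornerE Vx mulr0 addr0 pf.
Qed.

(** The operator is diagonal in the monomial basis. *)
Lemma qdiff_poly_solve (a b : C) (K : {poly C}) :
  (forall n : nat, a != b * q ^+ n) ->
  exists G : {poly C}, a *: G - b *: dilate q G = K.
Proof.
move=> ab; exists (\poly_(i < size K) (K`_i / (a - b * q ^+ i))).
apply/polyP=> i; rewrite coefB !coefZ coef_dilate coef_poly.
case: ltnP => [_|le]; last by rewrite nth_default // !mulr0 subrr.
have d0 : a - b * q ^+ i != 0 by rewrite subr_eq0.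
by field.
Qed.

(** The two leading coefficients differ by a factor a q^i / b. *)
Lemma qdiff_poly_inj (a b : C) (V G : {poly C}) :
  (forall n : int, a != b * q ^ n) -> V != 0 ->
  a *: (dilate q V * G) = b *: (V * dilate q G) -> G = 0.
Proof.
move=> ab V0 e; apply/eqP/negPn/negP => G0.
have /(congr1 lead_coef) := e.
rewrite !lead_coefZ !lead_coefM !lead_coef_dilate // => e'.
set m := (size V).-1 in e'; set n := (size G).-1 in e'.
have l0 : lead_coef V * lead_coef G != 0 by rewrite mulf_neq0 ?lead_coef_eq0.
have {}e' : a * q ^+ m = b * q ^+ n.
  by apply: (mulIf l0); move: e'; rewrite -!mulrA [_ * (q ^+ n * _)]mulrCA !mulrA.
have := ab (n%:Z - m%:Z); rewrite expfzDr // -exprnN mulrA -exprnP -e'.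
by rewrite mulfK ?eqxx // expf_neq0.
Qed.

Lemma dilate_prod_XsubC (s : seq C) :
  exists2 c : C, c != 0 &
  dilate q (\prod_(x <- s) ('X - x%:P)) =
    c *: \prod_(x <- [seq q^-1 * x | x <- s]) ('X - x%:P).
Proof.
elim: s => [|a s [c c0 e]]; first by exists 1; rewrite ?oner_eq0 // !big_nil rmorph1 scale1r.
exists (q * c); first by rewrite mulf_neq0.
have lin : dilate q ('X - a%:P) = q *: ('X - (q^-1 * a)%:P).
  apply/polyP=> n; rewrite coef_dilate coefZ !coefB !coefX !coefC.
  by case: n => [|[|n]]; rewrite /= ?mul1r ?subrr ?subr0 ?mulr0 ?expr1 // !sub0r mulrN mulVKf.
by rewrite /= !big_cons rmorphM /= e lin -scalerAl -scalerAr scalerA.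
Qed.

(** The hypothesis on H is necessary: at x and x / q the equation only involves
    the value G(x). Conversely, let G interpolate the values that the equation
    imposes at the points of s. Then the defect vanishes at all x and x / q, so it
    is V(z) V(qz) K(z), and replacing G by G + V G1 reduces the problem to
    a G1(z) - b G1(qz) = K(z). *)
Lemma qdiff_solve (a b : C) (s : seq C) (H : {poly C}) :
  let V := \prod_(x <- s) ('X - x%:P) in
  a != 0 -> (forall n : nat, a != b * q ^+ n) -> uniq s ->
  (forall x, x \in s -> q * x \notin s) ->
  (forall x, x \in s ->
     b * V.[q^-1 * x] * H.[x] + a * V.[q * x] * H.[q^-1 * x] = 0) ->
  exists G : {poly C}, a *: (dilate q V * G) - b *: (V * dilate q G) = H.
Proof.
move=> V a0 ab us qs comp.
have rV x : (V.[x] == 0) = (x \in s) by rewrite -/(root V x) root_prod_XsubC.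
have V0 x : x \in s -> V.[x] = 0 by rewrite -rV => /eqP.
have [G0 G0E] := interpolation (fun x => H.[x] / (a * V.[q * x])) us.
pose E := H - (a *: (dilate q V * G0) - b *: (V * dilate q G0)).
pose s' := [seq q^-1 * x | x <- s].
have dvdE : \prod_(x <- s ++ s') ('X - x%:P) %| E.
  apply: uniq_roots_dvdp.
    rewrite all_cat all_map; apply/andP; split; apply/allP => x xs; apply/rootP.
      have VqN : V.[q * x] != 0 by rewrite rV qs.
      rewrite /E !hornerE !horner_dilate (V0 x) // (G0E _ xs) /=.
      by field; rewrite a0 VqN.
    have VqN : V.[q * x] != 0 by rewrite rV qs.
    rewrite /E !hornerE !horner_dilate mulVKf // (V0 x) // (G0E _ xs) /=.
    have -> : H.[q^-1 * x] = - (b * V.[q^-1 * x] * H.[x]) / (a * V.[q * x]).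
      apply: (mulIf (mulf_neq0 a0 VqN)); rewrite mulfVK ?mulf_neq0 //.
      by rewrite mulrC; apply/eqP; rewrite -addr_eq0 addrC; apply/eqP; exact: comp.
    by field; rewrite a0 VqN.
  rewrite uniq_rootsE cat_uniq us map_inj_uniq ?us ?andbT; last first.
    by move=> x y /(mulfI (invr_neq0 q0)).
  apply/hasPn => _ /mapP[x xs ->]; apply/negP=> /qs.
  by rewrite mulVKf // xs.
have [c c0 cE] := dilate_prod_XsubC s.
have [K EK] : exists K, E = V * dilate q V * K.
  have /dvdpP[K EK] := dvdE; exists (c^-1 *: K).
  rewrite -/V in cE.
  by rewrite EK cE big_cat /= -/V -scalerAr -scalerAr -scalerAl scalerA mulVf // scale1r mulrC.
have [G1 G1E] := qdiff_poly_solve K ab.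
exists (G0 + V * G1).
have -> : H = E + (a *: (dilate q V * G0) - b *: (V * dilate q G0)) by rewrite subrK.
rewrite EK -G1E rmorphD rmorphM /= -!mul_polyC.
by ring.
Qed.
End FirstOrder.

(** * Prescribed Casorati determinants and the relations at the roots *)

Section QQSystem.
Variables (C : fieldType) (q : C) (kap : nat -> C) (N : nat).
Variables (rts : nat -> seq C) (W Lam : nat -> {poly C}).

Let V k := \prod_(x <- rts k) ('X - x%:P).

Hypothesis q0 : q != 0.
Hypothesis kap0 : forall i, (0 < i <= N)%N -> kap i != 0.
Hypothesis kap_disj : forall i j (n : int), (0 < i <= N)%N -> (0 < j <= N)%N ->
  i <> j -> kap i != kap j * q ^ n.
Hypothesis W0 : W 0%N = 1.
Hypothesis W1 : W 1%N = 1.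
Hypothesis W_neq0 : forall k, W k != 0.
Hypothesis Wrec : forall m,
  W m.+2 * dilate q (W m) = Lam m.+1 * W m.+1 * dilate q (W m.+1).
Hypothesis rts0 : rts 0%N = [::].

(** The Bethe equation at a root x of V_k, with the denominators cleared. It says
    that H = Lam_k(z) V_(k+1)(z) V_(k-1)(qz) satisfies the solvability condition
    of qdiff_solve for V = V_k, a = kap_k and b = kap_(k+1). *)
Definition bethe_relation (k : nat) (x : C) : Prop :=
  kap k.+1 * (Lam k).[x] * (V k.+1).[x] * (V k.-1).[q * x] * (V k).[q^-1 * x] +
  kap k * (Lam k).[q^-1 * x] * (V k.+1).[q^-1 * x] * (V k.-1).[x] * (V k).[q * x]
  = 0.

Lemma V_neq0 k : V k != 0.
Proof. by rewrite monic_neq0 ?monic_prod_XsubC. Qed.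

Lemma V0E : V 0%N = 1. Proof. by rewrite /V rts0 big_nil. Qed.

Lemma V_root k x : x \in rts k -> (V k).[x] = 0.
Proof. by move=> xk; apply/rootP; rewrite root_prod_XsubC. Qed.

Section Forward.
Variables (t : nat -> {poly C}) (al : nat -> C).
Hypothesis al_neq0 : forall k, (k <= N)%N -> al k != 0.
Hypothesis tE : forall k, (k <= N)%N -> casorati q kap t k k = al k *: (W k * V k).

(** At x and at x / q, casorati_rec with p = k + 1 involves the same value F of
    the unknown determinant; eliminate F. *)
Lemma casorati_bethe k x : (0 < k < N)%N -> x \in rts k ->
  (forall n : int, (W k).[q ^ n * x] != 0) -> bethe_relation k x.
Proof.
case: k => // k /andP[_ kN] xk Wx.
have rec := casorati_rec q t k.+2 (m := k) (kap := kap).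
have {}rec := rec (fun i h => kap0 (i := i) ltac:(lia)).
have Dx := V_root xk.
have Wx0 : (W k.+1).[x] != 0 by have := Wx 0; rewrite expr0z mul1r.
have Wqx : (W k.+1).[q * x] != 0 by have := Wx 1; rewrite expr1z.
have Wqx' : (W k.+1).[q^-1 * x] != 0 by have := Wx (-1); rewrite exprN1.
have recW := Wrec k.
move: rec; rewrite !tE; try lia.
set F := casorati _ _ _ _ _ => rec.
have e1 := congr1 (fun p => p.[x]) rec.
have e2 := congr1 (fun p => p.[q^-1 * x]) rec.
have w1 := congr1 (fun p => p.[x]) recW.
have w2 := congr1 (fun p => p.[q^-1 * x]) recW.
move: e1 e2 w1 w2; rewrite /= !(hornerM, hornerZ, hornerD, hornerN, horner_dilate) !(mulVKf q0).
rewrite Dx !(mulr0, mul0r, subr0, sub0r) => e1 e2 w1 w2.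
rewrite /bethe_relation /=.
set L1 := (Lam k.+1).[x] in w1 *; set L2 := (Lam k.+1).[_ * x] in w2 *.
set V2 := (V k.+2).[x] in e1 *; set V2' := (V k.+2).[_] in e2 *.
set Vk := (V k).[x] in e2 *; set Vk' := (V k).[_] in e1 *.
set V1 := (V k.+1).[q * x] in e1 *; set V1' := (V k.+1).[_] in e2 *.
have nz : al k.+2 * al k * al k.+1 * (W k.+1).[x] * (W k.+1).[q * x] * (W k.+1).[q^-1 * x] != 0.
  by rewrite !mulf_neq0 ?al_neq0 //; lia.
apply: (mulfI nz); rewrite mulr0.
(* Restore W_(k+2) and W_k by w1 and w2, and recognize the left sides of e1, e2. *)
transitivity (
  kap k.+2 * (al k.+1 * ((W k.+1).[q^-1 * x] * V1')) *
    (al k.+2 * al k * V2 * Vk' * (L1 * (W k.+1).[x] * (W k.+1).[q * x])) +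
  kap k.+1 * (al k.+1 * ((W k.+1).[q * x] * V1)) *
    (al k.+2 * al k * V2' * Vk * (L2 * (W k.+1).[q^-1 * x] * (W k.+1).[x]))).
  by ring.
rewrite -w1 -w2.
transitivity (
  kap k.+2 * (al k.+1 * ((W k.+1).[q^-1 * x] * V1')) *
    (al k.+2 * ((W k.+2).[x] * V2) * (al k * ((W k).[q * x] * Vk'))) +
  kap k.+1 * (al k.+1 * ((W k.+1).[q * x] * V1)) *
    (al k.+2 * ((W k.+2).[q^-1 * x] * V2') * (al k * ((W k).[x] * Vk)))).
  by ring.
by rewrite e1 e2; ring.
Qed.
End Forward.

Section Backward.
Variable al : nat -> C.
Hypothesis al_neq0 : forall k, (k <= N)%N -> al k != 0.
Hypothesis al0 : al 0%N = 1.
Hypothesis rts_uniq : forall k, uniq (rts k).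
Hypothesis rts_shift : forall k x (n : int), x \in rts k -> n != 0 ->
  q ^ n * x \notin rts k.
Hypothesis rts_disj : forall k x (n : int), x \in rts k ->
  q ^ n * x \notin rts k.+1.
Hypothesis bethe : forall k x, (0 < k < N)%N -> x \in rts k -> bethe_relation k x.

Lemma V_next_neq0 k x (n : int) : x \in rts k -> (V k.+1).[q ^ n * x] != 0.
Proof. by move=> xk; rewrite -/(root _ _) root_prod_XsubC rts_disj. Qed.

(** The equation of casorati_rec for F(p, m) = W_m G_m, divided by its common
    factors W_m(z) W_m(qz). *)
Definition ladder_eq (p : nat) (G : nat -> {poly C}) (m : nat) : Prop :=
  (al m * kap m) *: (dilate q (V m) * G m) - (al m * kap p) *: (V m * dilate q (G m)) =
  al m.-1 *: (Lam m * G m.+1 * dilate q (V m.-1)).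

(** The equation for g = G_(m+1), evaluated at x / q for a root x of V_m, where its
    right side vanishes. *)
Definition transport (p : nat) (g : {poly C}) (m : nat) : Prop :=
  forall x, x \in rts m ->
  kap m.+1 * (V m.+1).[x] * g.[q^-1 * x] = kap p * (V m.+1).[q^-1 * x] * g.[x].

(** Multiply the solvability condition at x by V_(m+1)(x/q). The transport
    relation of g turns it into g(x/q) times the Bethe relation at x. The new
    solution satisfies its own transport relation because its right side has the
    factor V_(m-1)(qz). *)
Lemma ladder_step p m (g : {poly C}) : (0 < m < p)%N -> (p <= N)%N ->
  transport p g m ->
  exists g', [/\
    (al m * kap m) *: (dilate q (V m) * g') - (al m * kap p) *: (V m * dilate q g') =
      al m.-1 *: (Lam m * g * dilate q (V m.-1)) & transport p g' m.-1].
Proof.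
move=> mp pN tr.
have am : al m != 0 by apply: al_neq0; lia.
have km : kap m != 0 by apply: kap0; lia.
have ne (n : nat) : al m * kap m != al m * kap p * q ^+ n.
  rewrite -mulrA; apply: contra_neq (kap_disj n%:Z (i := m) (j := p) _ _ _); try lia.
  by move/(mulfI am).
have sq x : x \in rts m -> q * x \notin rts m.
  by move=> xm; have := rts_shift xm (n := 1); rewrite expr1z; apply.
have cond x : x \in rts m ->
     (al m * kap p) * (V m).[q^-1 * x] * (al m.-1 *: (Lam m * g * dilate q (V m.-1))).[x] +
     (al m * kap m) * (V m).[q * x] * (al m.-1 *: (Lam m * g * dilate q (V m.-1))).[q^-1 * x] = 0.
  move=> xm; have T := tr x xm; have B := bethe (k := m) ltac:(lia) xm.
  have nz : (V m.+1).[q^-1 * x] != 0.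
    by have := V_next_neq0 (-1) xm; rewrite exprN1.
  rewrite !(hornerM, hornerZ, horner_dilate) (mulVKf q0).
  apply: (mulfI nz); rewrite mulr0.
  transitivity (al m * al m.-1 * g.[q^-1 * x] * 0); last by rewrite mulr0.
  rewrite -[X in _ = _ * X]B.
  transitivity (al m * al m.-1 * ((V m).[q^-1 * x] * (Lam m).[x] * (V m.-1).[q * x] *
      (kap p * (V m.+1).[q^-1 * x] * g.[x]) +
      kap m * (V m).[q * x] * (V m.+1).[q^-1 * x] * (Lam m).[q^-1 * x] *
      g.[q^-1 * x] * (V m.-1).[x])).
    by ring.
  by rewrite -T; ring.
have [g' g'E] := qdiff_solve q0 (mulf_neq0 am km) ne (rts_uniq m) sq cond.
exists g'; split; first exact: g'E.
case: m mp am km {tr ne sq cond} g'E => // m mp am km /= e x xm.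
have := congr1 (fun p => p.[q^-1 * x]) e.
rewrite /= !(hornerM, hornerZ, hornerD, hornerN, horner_dilate) !(mulVKf q0).
rewrite (V_root xm) !mulr0 => /eqP; rewrite subr_eq0 => /eqP e'.
by apply: (mulfI am); rewrite !mulrA; rewrite !mulrA in e'.
Qed.

(** Solve the equations for m = p - 1, ..., 1. The start G_p = alpha_p V_p
    satisfies the transport relation trivially. *)
Lemma ladder p : (0 < p <= N)%N ->
  exists G : nat -> {poly C}, G p = al p *: V p /\
    forall m, (0 < m < p)%N -> ladder_eq p G m.
Proof.
move=> pN.
suff partial j : (j < p)%N -> exists G : nat -> {poly C},
    [/\ G p = al p *: V p,
        forall m, (p - j <= m < p)%N -> ladder_eq p G m &
        transport p (G (p - j)%N) (p - j).-1].
  have [G [Gp GE _]] := partial p.-1 ltac:(lia).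
  by exists G; split=> // m mp; apply: GE; lia.
elim: j => [|j IH] jp.
    exists (fun _ => al p *: V p); split=> //; first by move=> m; lia.
    rewrite subn0 => x _; rewrite !hornerZ prednK; last by lia.
    by ring.
  have [G [Gp GE T]] := IH ltac:(lia).
  have [g' [g'E T']] := ladder_step (p := p) (m := (p - j.+1)%N) (g := G (p - j)%N)
    ltac:(lia) ltac:(lia) ltac:(by rewrite subnS).
exists (fun m => if (m == p - j.+1)%N then g' else G m); split.
- by rewrite ifN //; lia.
- move=> m mp; rewrite /ladder_eq; case: eqP => [->|ne].
    have -> : (p - j.+1).+1 = (p - j)%N by lia.
    have -> : (p - j == p - j.+1)%N = false by apply/eqP; lia.
    exact: g'E.
  by rewrite ifN; [apply: GE; lia | lia].
by rewrite eqxx.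
Qed.

(** The section t_(K+1) is the bottom G_1 of the ladder for p = K + 1. Climbing
    up again, casorati_rec gives F(K+1, m) = W_m G_m for all m. *)
Lemma casorati_exists_upto K : (K <= N)%N ->
  exists t : nat -> {poly C},
    (forall k, (k <= K)%N -> casorati q kap t k k = al k *: (W k * V k)) /\
    (forall m p, (0 < m <= p)%N -> (p <= K)%N -> W m %| casorati q kap t p m).
Proof.
elim: K => [|K IH] KN.
  exists (fun _ => 0); split; last by move=> m p; lia.
  by move=> k; rewrite leqn0 => /eqP ->; rewrite casorati0 al0 W0 V0E mulr1 scale1r.
have [t [tE tW]] := IH (ltnW KN).
have [G [GK GE]] := ladder (p := K.+1) ltac:(lia).
pose t' i := if i == K.+1 then G 1%N else t i.
have old p m : (p <= K)%N -> (m <= p)%N -> casorati q kap t' p m = casorati q kap t p m.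
  move=> pK mp; case: m mp => [|m] mp; first by rewrite !casorati0.
  apply: eq_casorati => //; first by rewrite /t' ifN //; lia.
  by move=> i im; rewrite /t' ifN //; lia.
have new m : (m < K.+1)%N -> casorati q kap t' K.+1 m.+1 = W m.+1 * G m.+1.
  elim: m => [|m IHm] mK; first by rewrite casorati1 W1 mul1r /t' eqxx.
  have rec := casorati_rec q t' K.+1 (m := m) (kap := kap)
    (fun i h => kap0 (i := i) ltac:(lia)).
  rewrite IHm in rec; last by lia.
  rewrite (old m m) ?(old m.+1 m.+1) ?tE in rec; try lia.
  have nz : dilate q (al m *: (W m * V m)) != 0.
    by rewrite dilate_eq0 // scaler_eq0 negb_or al_neq0 ?mulf_neq0 ?W_neq0 ?V_neq0 //; lia.
  apply: (mulIf nz); rewrite rec.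
  have g := GE m.+1 ltac:(lia); have w := Wrec m.
  rewrite /ladder_eq /= in g.
  move: g w; rewrite -!mul_polyC !rmorphM /= !dilateC => g w.
  transitivity (W m.+1 * dilate q (W m.+1) *
    ((al m.+1)%:P * (kap m.+1)%:P * (dilate q (V m.+1) * G m.+1) -
       (al m.+1)%:P * (kap K.+1)%:P * (V m.+1 * dilate q (G m.+1)))); first by ring.
  rewrite g.
  transitivity (Lam m.+1 * W m.+1 * dilate q (W m.+1) *
     ((al m)%:P * G m.+2 * dilate q (V m))); first by ring.
  by rewrite -w; ring.
exists t'; split=> [k kK|m p mp pK].
  have [kK'|->] : (k <= K)%N \/ k = K.+1 by lia.
    by rewrite old ?tE.
  by rewrite new // GK scalerAr.
have [pK'|->] : (p <= K)%N \/ p = K.+1 by lia.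
  by rewrite old ?tW //; lia.
case: m mp => // m mp.
by rewrite new ?dvdp_mulr //; lia.
Qed.
End Backward.

(** Going down in m, the difference of the two determinants F(p, m) solves a
    homogeneous equation, which has no other polynomial solution than 0. *)
Lemma casorati_unique (t t' : nat -> {poly C}) :
  (forall k, (k <= N)%N -> casorati q kap t k k != 0) ->
  (forall k, (k <= N)%N -> casorati q kap t k k = casorati q kap t' k k) ->
  forall p, (0 < p <= N)%N -> t p = t' p.
Proof.
move=> nz e p; elim/ltn_ind: p => p IH pN.
suff key : forall j, (j < p)%N -> casorati q kap t p (p - j) = casorati q kap t' p (p - j).
  by have := key p.-1 ltac:(lia); rewrite (_ : p - p.-1 = 1)%N ?casorati1 //; lia.
elim=> [|j IHj] jp; first by rewrite subn0 e //; lia.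
have {}IHj := IHj ltac:(lia).
have [m mE] : exists m, (p - j.+1 = m.+1)%N by exists (p - j.+2)%N; lia.
have mE' : (p - j = m.+2)%N by lia.
rewrite mE; rewrite mE' in IHj.
have DD k : (k <= m.+1)%N -> casorati q kap t' k k = casorati q kap t k k.
  by move=> km; rewrite e //; lia.
have kk : forall i, (0 < i <= m)%N -> kap i != 0 by move=> i im; apply: kap0; lia.
have r := casorati_rec q t p kk.
have r' := casorati_rec q t' p kk.
rewrite !DD // in r'.
apply/eqP; rewrite -subr_eq0; apply/eqP.
apply: (@qdiff_poly_inj _ q q0 (kap m.+1) (kap p) (casorati q kap t m.+1 m.+1)).
- by move=> n; apply: kap_disj; lia.
- by apply: nz; lia.
apply/eqP; rewrite -subr_eq0 rmorphB /= !mulrBr !scalerBr.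
have := r; rewrite IHj r' => /eqP; rewrite -subr_eq0 => /eqP {}r.
apply/eqP; rewrite -[RHS]oppr0 -[in RHS]r.
by rewrite -!mul_polyC; ring.
Qed.
End QQSystem.

(** * The polynomials W_k and the Bethe equations in the variables v *)

Lemma prod_neq0 (R : idomainType) (I : Type) (r : seq I) (P : pred I) (F : I -> R) :
  (forall i, F i != 0) -> \prod_(i <- r | P i) F i != 0.
Proof. by move=> F0; elim/big_ind: _ => //; [exact: oner_neq0 | exact: mulf_neq0]. Qed.

Section Weights.
Variables (C : fieldType) (q : C) (L : nat) (z : 'I_L -> C) (l : 'I_L -> nat -> nat).
Hypothesis q0 : q != 0.

Definition Lambda_shift (k : nat) : {poly C} := dilate (q ^+ k.-1) (Lambda q z l k).

Lemma Ppoly0 : Ppoly q z l 0 = 1.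
Proof. by rewrite /Ppoly big_nil. Qed.

Lemma PpolyS m : Ppoly q z l m.+1 = Ppoly q z l m * Lambda q z l m.+1.
Proof. by rewrite /Ppoly big_nat_recr. Qed.

Lemma Wpoly0 : Wpoly q z l 0 = 1.
Proof. by rewrite /Wpoly big_nil. Qed.

Lemma Wpoly1 : Wpoly q z l 1 = 1.
Proof. by rewrite /Wpoly big_nil. Qed.

Lemma WpolyS m : Wpoly q z l m.+2 = Wpoly q z l m.+1 * dilate (q ^+ m) (Ppoly q z l m.+1).
Proof. by rewrite /Wpoly big_nat_recr. Qed.

Lemma dilate_WpolyS m :
  dilate q (Wpoly q z l m.+1) = dilate q (Wpoly q z l m) * dilate (q ^+ m) (Ppoly q z l m).
Proof.
case: m => [|m]; first by rewrite Ppoly0 Wpoly0 Wpoly1 !rmorph1 mulr1.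
by rewrite WpolyS rmorphM /= dilateM exprS.
Qed.

(** The quotients W_(m+2)(z) / W_(m+1)(z) and W_(m+1)(qz) / W_m(qz) are the
    values at q^m z of P_(m+1) and P_m, and P_(m+1) = P_m Lambda_(m+1). *)
Lemma Wpoly_rec m :
  Wpoly q z l m.+2 * dilate q (Wpoly q z l m) =
  Lambda_shift m.+1 * Wpoly q z l m.+1 * dilate q (Wpoly q z l m.+1).
Proof. by rewrite WpolyS PpolyS dilate_WpolyS rmorphM /= /Lambda_shift /=; ring. Qed.

Lemma Lambda_neq0 i : Lambda q z l i != 0.
Proof. by apply: prod_neq0 => m; apply: prod_neq0 => j; rewrite polyXsubC_eq0. Qed.

Lemma Ppoly_neq0 i : Ppoly q z l i != 0.
Proof. by apply: prod_neq0 => j; exact: Lambda_neq0. Qed.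

Lemma Wpoly_neq0 k : Wpoly q z l k != 0.
Proof.
by apply: prod_neq0 => j; rewrite dilate_eq0 ?Ppoly_neq0 // expf_neq0.
Qed.

Lemma Wpoly_lattice_neq0 k x :
  (forall m, disjoint_lattices q x (z m)) -> forall n : int, (Wpoly q z l k).[q ^ n * x] != 0.
Proof.
move=> xz n; rewrite /Wpoly horner_prod; apply: prod_neq0 => j.
rewrite horner_dilate horner_prod; apply: prod_neq0 => i.
rewrite horner_prod; apply: prod_neq0 => m; rewrite horner_prod; apply: prod_neq0 => h.
by rewrite hornerXsubC subr_eq0 mulrA exprnN exprnP -expfzDr //; exact: xz.
Qed.

Lemma Wpoly_at0_neq0 k : (forall m, z m != 0) -> (Wpoly q z l k).[0] != 0.
Proof.
move=> z0; rewrite /Wpoly horner_prod; apply: prod_neq0 => j.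
rewrite horner_dilate mulr0 horner_prod; apply: prod_neq0 => i.
rewrite horner_prod; apply: prod_neq0 => m; rewrite horner_prod; apply: prod_neq0 => h.
by rewrite hornerXsubC sub0r oppr_eq0 mulf_neq0 // invr_neq0 // expf_neq0.
Qed.

(** The zeros of Lambda_k form a string in each lattice, so the ratio of its
    values at x and x / q only sees the two ends of the strings. *)
Lemma Lambda_shift_telescope k x : (0 < k)%N ->
  (Lambda_shift k).[x] * \prod_(m < L) (q ^ ((ell l m k.-1 + k)%N%:Z - 2) * x - z m) =
  (Lambda_shift k).[q^-1 * x] * \prod_(m < L) (q ^ ((ell l m k + k)%N%:Z - 2) * x - z m).
Proof.
case: k => // k _; rewrite /Lambda_shift !horner_dilate /Lambda !horner_prod -!big_split /=.
apply: eq_bigr => m _; rewrite !horner_prod.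
have le : (ell l m k <= ell l m k.+1)%N by rewrite /ell [X in (_ <= X)%N]big_nat_recr //= leq_addr.
pose f (j : nat) := q ^ ((j + k.+1)%N%:Z - 2) * x - z m.
have e1 j : (('X - (q ^- j * z m)%:P).[q ^+ k * x]) = q ^- j * f j.+1.
  rewrite hornerXsubC /f mulrBr mulrA exprnN -expfzDr // exprnP.
  by congr (q ^ _ * x - _); lia.
have e2 j : (('X - (q ^- j * z m)%:P).[q ^+ k * (q^-1 * x)]) = q ^- j * f j.
  rewrite hornerXsubC /f mulrBr !mulrA exprnN -expfzDr // exprnP -exprN1 -expfzDr //.
  by congr (q ^ _ * x - _); lia.
under eq_bigr do rewrite e1; under [in RHS]eq_bigr do rewrite e2.
have tel a b : (a <= b)%N ->
    \prod_(a <= j < b) f j.+1 * f a = \prod_(a <= j < b) f j * f b.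
  elim: b => [|b IH]; first by rewrite leqn0 => /eqP ->; rewrite !big_geq.
  rewrite leq_eqVlt => /predU1P[<-|]; first by rewrite !big_geq.
  rewrite ltnS => ab; rewrite !big_nat_recr //= mulrAC IH //.
by rewrite !big_split /= -!mulrA; congr (_ * _); exact: tel.
Qed.
End Weights.

Section BetheEquations.
Variables (C : fieldType) (q qh : C) (N L : nat) (z : 'I_L -> C) (l : 'I_L -> nat -> nat).
Variables (kappa : nat -> C) (u : nat -> seq C).
Hypotheses (q0 : q != 0) (qhE : qh ^+ 2 = q).

Lemma qh_neq0 : qh != 0.
Proof. by apply: contraNneq q0 => e; rewrite -qhE e expr0n. Qed.

Lemma expq_qh (n : int) : q ^ n = qh ^ (2 * n).
Proof. by rewrite -qhE exprnP exprz_exp. Qed.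

Lemma level_rescale k :
  level N (rescale qh u) k = [seq qh ^ (1 - k%:Z) * x | x <- level N u k].
Proof. by rewrite /level; case: ifP. Qed.

(** The factors q^((1-k)/2) cancel in each quotient. *)
Lemma Vpoly_ratio k (x y : C) :
  \prod_(c <- level N u k) ((x - c) / (y - c)) =
  (Vpoly N (rescale qh u) k).[qh ^ (1 - k%:Z) * x] /
  (Vpoly N (rescale qh u) k).[qh ^ (1 - k%:Z) * y].
Proof.
rewrite /Vpoly level_rescale !horner_prod !big_map -prodf_div.
apply: eq_bigr => c _; rewrite !hornerXsubC -!mulrBr.
by rewrite -mulf_div divff ?mul1r // expfz_neq0 // qh_neq0.
Qed.

Let V := Vpoly N (rescale qh u).
Let Lt := Lambda_shift q z l.

Lemma bethe_lhsE (k : nat) (x : C) (y := qh ^ (1 - k%:Z) * x) : (0 < k)%N ->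
  bethe_lhs q qh N z l kappa u k x =
  kappa k.+1 / kappa k *
  ((\prod_(m < L) (q ^ ((ell l m k + k)%N%:Z - 2) * y - z m)) /
   (\prod_(m < L) (q ^ ((ell l m k.-1 + k)%N%:Z - 2) * y - z m))) *
  ((V k.-1).[q * y] / (V k.-1).[y]) * ((V k).[q^-1 * y] / (V k).[q * y]) *
  ((V k.+1).[y] / (V k.+1).[q^-1 * y]).
Proof.
move=> k0; have h0 := qh_neq0.
have pw (a b : int) w : qh ^ a * (qh ^ b * w) = qh ^ (a + b) * w.
  by rewrite mulrA expfzDr.
have pqh a w : qh ^ a * (qh * w) = qh ^ (a + 1) * w by rewrite -pw expr1z.
have pqh' a w : qh ^ a * (qh^-1 * w) = qh ^ (a - 1) * w by rewrite -pw exprN1.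
have pq a w : q * (qh ^ a * w) = qh ^ (2 + a) * w by rewrite -pw -exprnP qhE.
have pq' a w : q^-1 * (qh ^ a * w) = qh ^ (-2 + a) * w.
  by rewrite -pw -exprnN qhE.
rewrite /bethe_lhs !Vpoly_ratio -/V -prodf_div.
congr (_ * _ * _ * _ * _).
- apply: eq_bigr => m _; rewrite /y !expq_qh !pw.
  by congr ((qh ^ _ * x - _) / (qh ^ _ * x - _)); lia.
- rewrite /y pqh pqh' pq; congr (_.[qh ^ _ * x] / _.[qh ^ _ * x]); lia.
- rewrite /y pq pq'; congr (_.[_] / _.[_]); rewrite mulrCA ?pq ?pq' //.
- rewrite /y pqh pqh' pq'; congr (_.[qh ^ _ * x] / _.[qh ^ _ * x]); lia.
Qed.

Lemma bethe_nondegenerate_rescale :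
  bethe_nondegenerate q qh N z u <-> roots_nondegenerate q N z (rescale qh u).
Proof.
have h0 := qh_neq0.
have nthr k a : (a < size (u k))%N -> nth 0 (rescale qh u k) a = qh ^ (1 - k%:Z) * nth 0 (u k) a.
  by move=> ak; rewrite (nth_map 0).
have move_pow (a b : int) (x y : C) : (qh ^ a * x == qh ^ b * y) = (x == qh ^ (b - a) * y).
  rewrite -(inj_eq (mulfI (expfz_neq0 (- a) h0))) !mulrA -!expfzDr // addNr expr0z mul1r.
  by rewrite [- a + b]addrC.
split=> [[B A]|[A B]]; split.
- move=> k a k' a' kN ak kN' ak' ne m n.
  rewrite size_map in ak; rewrite size_map in ak'.
  rewrite !nthr // !expq_qh !mulrA -!expfzDr // move_pow.
  have := A _ _ _ _ kN ak kN' ak' ne (n - m); rewrite expq_qh mulrA -expfzDr //.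
  by apply: contra; congr (_ == qh ^ _ * _); lia.
- move=> k a m kN ak i n; rewrite size_map in ak.
  rewrite nthr // eq_sym !expq_qh !mulrA -!expfzDr // move_pow.
  have := B m _ _ kN ak (i - n); rewrite expq_qh mulrA -expfzDr //.
  by apply: contra; congr (_ == qh ^ _ * _); lia.
- move=> m k a kN ak n.
  have := B k a m kN; rewrite size_map => /(_ ak n 0); rewrite expr0z mul1r eq_sym nthr //.
  by apply: contra; rewrite mulrCA.
- move=> k a k' a' kN ak kN' ak' ne n.
  have := A k a k' a' kN; rewrite !size_map => /(_ ak kN' ak' ne 0 n).
  rewrite expr0z mul1r !nthr //; apply: contra.
  rewrite !expq_qh !mulrA -!expfzDr // move_pow.
  by congr (_ == qh ^ _ * _); lia.
Qed.

Lemma bethe_relationE k x (y := qh ^ (1 - k%:Z) * x) : (0 < k)%N ->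
  kappa k != 0 ->
  (Lt k).[q^-1 * y] != 0 ->
  \prod_(m < L) (q ^ ((ell l m k.-1 + k)%N%:Z - 2) * y - z m) != 0 ->
  (V k.-1).[y] != 0 -> (V k).[q * y] != 0 -> (V k.+1).[q^-1 * y] != 0 ->
  bethe_lhs q qh N z l kappa u k x = -1 <->
  bethe_relation q kappa (level N (rescale qh u)) Lt k y.
Proof.
move=> k0 n1 n2 n3 n4 n5 n6; rewrite bethe_lhsE // -/y.
have -> : \prod_(m < L) (q ^ ((ell l m k + k)%N%:Z - 2) * y - z m) /
     \prod_(m < L) (q ^ ((ell l m k.-1 + k)%N%:Z - 2) * y - z m) =
     (Lt k).[y] / (Lt k).[q^-1 * y].
  by apply/eqP; rewrite eqr_div // mulrC -Lambda_shift_telescope.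
rewrite /bethe_relation -/(Vpoly N (rescale qh u) k) -/(Vpoly N (rescale qh u) k.+1).
rewrite -/(Vpoly N (rescale qh u) k.-1) -/V.
set D := kappa k * (Lt k).[q^-1 * y] * (V k.+1).[q^-1 * y] * (V k.-1).[y] * (V k).[q * y].
set E := kappa k.+1 * (Lt k).[y] * (V k.+1).[y] * (V k.-1).[q * y] * (V k).[q^-1 * y].
have D0 : D != 0 by rewrite !mulf_neq0.
rewrite [X in X = -1 <-> _](_ : _ = E / D); last by rewrite /E /D; field; rewrite n1 n2 n4 n5 n6.
split=> [e|/eqP e].
  by rewrite -[E](divfK D0) e mulN1r addNr.
by rewrite addr_eq0 in e; rewrite (eqP e) mulNr divff.
Qed.
End BetheEquations.

Section RootsNondegenerate.
Variables (C : fieldType) (q : C) (N L : nat) (z : 'I_L -> C) (v : nat -> seq C).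
Hypothesis q_nroot : not_root_of_unity q.
Hypothesis nd : roots_nondegenerate q N z v.

Lemma mem_level k x : x \in level N v k -> (0 < k < N)%N /\ x \in v k.
Proof. by rewrite /level; case: ifP. Qed.

Lemma level_uniq k : uniq (level N v k).
Proof.
rewrite /level; case: ifP => // kN; apply/(uniqP 0) => i j; rewrite !inE => ik jk e.
apply/eqP; apply: contraT => /eqP ij.
have ne : (k, i) <> (k, j) by case.
by have := nd.1 k i k j kN ik kN jk ne 0 0; rewrite e eqxx.
Qed.

Lemma level_disjoint k k' x y : x \in level N v k -> y \in level N v k' ->
  (k, x) <> (k', y) -> disjoint_lattices q x y.
Proof.
case/mem_level=> kN xk /mem_level[kN' yk'] ne.
rewrite -(nth_index 0 xk) -(nth_index 0 yk'); apply: nd.1; rewrite ?index_mem //.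
by case=> e e'; apply: ne; subst k'; rewrite -(nth_index 0 xk) e' nth_index.
Qed.

Lemma level_disjoint_z k x m : x \in level N v k -> disjoint_lattices q x (z m).
Proof.
by case/mem_level=> kN xk; rewrite -(nth_index 0 xk); apply: nd.2; rewrite ?index_mem.
Qed.

Lemma expq_neq1 (n : int) : n != 0 -> q ^ n != 1.
Proof.
case: n => n n0; first by rewrite -exprnP; apply: q_nroot; rewrite lt0n.
by rewrite NegzE -exprnN invr_eq1; apply: q_nroot.
Qed.

Lemma level_shift k x (n : int) : x != 0 -> x \in level N v k -> n != 0 ->
  q ^ n * x \notin level N v k.
Proof.
move=> x0 xk n0; apply/negP => yk.
have ne : (k, x) <> (k, q ^ n * x).
  case=> /eqP; rewrite -{1}[x]mul1r (inj_eq (mulIf x0)) eq_sym.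
  by apply/negP; exact: expq_neq1.
by have := level_disjoint xk yk ne n 0; rewrite expr0z mul1r eqxx.
Qed.

Lemma level_next k x (n : int) : x \in level N v k -> q ^ n * x \notin level N v k.+1.
Proof.
move=> xk; apply/negP => yk.
have ne : (k, x) <> (k.+1, q ^ n * x) by case=> /n_Sn.
by have := level_disjoint xk yk ne n 0; rewrite expr0z mul1r eqxx.
Qed.
End RootsNondegenerate.

Lemma Lambda_shift_lattice_neq0 (C : fieldType) (q : C) (L : nat) (z : 'I_L -> C)
    (l : 'I_L -> nat -> nat) (k : nat) (x : C) : q != 0 ->
  (forall m, disjoint_lattices q x (z m)) ->
  forall n : int, (Lambda_shift q z l k).[q ^ n * x] != 0.
Proof.
move=> q0 xz n; rewrite horner_dilate horner_prod; apply: prod_neq0 => m.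
rewrite horner_prod; apply: prod_neq0 => h.
by rewrite hornerXsubC subr_eq0 mulrA exprnN exprnP -expfzDr //; exact: xz.
Qed.

Section BetheSolutions.
Variables (C : fieldType) (q qh : C) (N L : nat) (z : 'I_L -> C) (l : 'I_L -> nat -> nat).
Variables (kappa : nat -> C) (u : nat -> seq C).
Hypotheses (q0 : q != 0) (qhE : qh ^+ 2 = q) (q_nroot : not_root_of_unity q).
Hypothesis kappa_neq0 : forall i : nat, (0 < i <= N)%N -> kappa i != 0.
Hypothesis nd : roots_nondegenerate q N z (rescale qh u).

Let rts := level N (rescale qh u).

Lemma mem_level_rescale k x :
  (qh ^ (1 - k%:Z) * x \in rts k) = (x \in level N u k).
Proof.
rewrite /rts level_rescale mem_map //; apply: mulfI.
by rewrite expfz_neq0 // (qh_neq0 q0 qhE).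
Qed.

(** Nonvanishing of the roots is equivalent to q x - x <> 0, one of the
    denominators; the other denominators are nonzero by nondegeneracy. *)
Lemma bethe_solutionP :
  bethe_solution q qh N z l kappa u <->
  (forall k y, y \in rts k -> y != 0) /\
  (forall k y, (0 < k < N)%N -> y \in rts k ->
     bethe_relation q kappa rts (Lambda_shift q z l) k y).
Proof.
have h0 := qh_neq0 q0 qhE.
have key k x (y := qh ^ (1 - k%:Z) * x) : (0 < k < N)%N -> x != 0 -> y \in rts k ->
    bethe_denominators_neq0 q qh N z l u k x /\
    (bethe_lhs q qh N z l kappa u k x = -1 <->
      bethe_relation q kappa rts (Lambda_shift q z l) k y).
  move=> kN x0 yk.
  have y0 : y != 0 by rewrite mulf_neq0 ?expfz_neq0.
  have yz m := level_disjoint_z nd m yk.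
  have zn m (n : int) : q ^ n * y - z m != 0.
    by rewrite subr_eq0; have := yz m n 0; rewrite expr0z mul1r.
  have rV k' w : ((Vpoly N (rescale qh u) k').[w] != 0) = (w \notin rts k').
    by rewrite -/(root _ _) root_prod_XsubC.
  have Vprev : y \notin rts k.-1.
    apply/negP => yk'; have ne : (k, y) <> (k.-1, y) by case; lia.
    by have := level_disjoint nd yk yk' ne 0 0; rewrite eqxx.
  have Vsame : q * y \notin rts k.
    by have := level_shift q_nroot nd y0 yk (n := 1); rewrite expr1z; apply.
  have Vnext : q^-1 * y \notin rts k.+1.
    by have := level_next nd (-1) yk; rewrite exprN1.
  split; last first.
    apply: bethe_relationE; rewrite ?rV //; try lia.
    - by apply: kappa_neq0; lia.
    - by have := Lambda_shift_lattice_neq0 l k q0 yz (-1); rewrite exprN1.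
    - exact: prod_neq0.
  split=> [m|c ck|b bk|d dk]; rewrite subr_eq0.
  - have := zn m ((ell l m k.-1 + k)%N%:Z - 2); rewrite subr_eq0 /y (expq_qh qhE) mulrA -expfzDr //.
    by apply: contra; congr (qh ^ _ * x == _); lia.
  - apply: contra Vprev => /eqP e; rewrite -mem_level_rescale -e in ck.
    rewrite (_ : y = qh ^ (1 - k.-1%:Z) * (qh^-1 * x)) //.
    by rewrite /y -[qh^-1]exprN1 mulrA -expfzDr //; congr (qh ^ _ * _); lia.
  - apply: contra Vsame => /eqP e; rewrite -mem_level_rescale -e in bk.
    by rewrite /y mulrCA.
  - apply: contra Vnext => /eqP e; rewrite -mem_level_rescale -e in dk.
    rewrite (_ : q^-1 * y = qh ^ (1 - k.+1%:Z) * (qh^-1 * x)) //.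
    rewrite /y -qhE -[qh^-1]exprN1 exprnN !mulrA -!expfzDr //.
    by congr (qh ^ _ * _); lia.
split=> [sol|[y0 rel] k x kN xk].
  have nz k y : y \in rts k -> y != 0.
    rewrite /rts level_rescale => /mapP[x xk ->].
    have [kN xk'] := mem_level xk.
    have [[_ _ den _] _] := sol k x kN xk'.
    rewrite mulf_neq0 ?expfz_neq0 //.
    by apply: contraTneq (den x xk) => ->; rewrite mulr0 subr0 eqxx.
  split=> // k y kN yk; have := nz k y yk.
  move: yk; rewrite {1}/rts level_rescale => /mapP[x xk ->] yx0.
  have x0 : x != 0 by apply: contraNneq yx0 => ->; rewrite mulr0.
  apply/(key k x kN x0 _).2; first by rewrite mem_level_rescale.
  by have [_ xk'] := mem_level xk; exact: (sol k x kN xk').2.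
have yk : qh ^ (1 - k%:Z) * x \in rts k.
  by rewrite mem_level_rescale /level kN.
have x0 : x != 0 by apply: contraNneq (y0 k _ yk) => ->; rewrite mulr0.
have [den eqv] := key k x kN x0 yk.
by split=> //; apply/eqv; apply: rel.
Qed.
End BetheSolutions.

Section QWronskian.
Variables (C : fieldType) (q : C) (N : nat) (kappa : nat -> C).

(** With the sections numbered backwards, the k-th q-oper equation involves the
    first k of them. *)
Definition rev_index (s : nat -> {poly C}) (p : nat) : {poly C} := s (N.+1 - p)%N.

Lemma qwronskianE s k : (k <= N)%N ->
  qwronskian q N kappa s k = casorati q kappa (rev_index s) k k.
Proof.
move=> kN; congr (\det _); apply/matrixP=> i j; rewrite !mxE /qentry /rev_index /zeta.
have ik := ltn_ord i.
have -> : (N.+1 - (N - k + i).+1 = qrow k k i)%N.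
  by rewrite /qrow; case: (nat_of_ord i) ik => *; lia.
have -> // : ((N - k + i).+1 = N.+1 - qrow k k i)%N.
by rewrite /qrow; case: (nat_of_ord i) ik => *; lia.
Qed.

(** At z = 0 the dilations act trivially, so row i is a multiple of the powers of
    its twist. *)
Lemma casorati_at0 (t : nat -> {poly C}) k :
  (casorati q kappa t k k).[0] =
  (\prod_(i < k) (t (k - i)%N).[0]) * \det (Vandermonde k (\row_(i < k) kappa (k - i)%N)).
Proof.
have -> : \det (Vandermonde k (\row_(i < k) kappa (k - i)%N)) =
    lminor k (fun i j => kappa (k - i)%N ^+ j).
  by rewrite -det_tr; congr (\det _); apply/matrixP=> i j; rewrite !mxE.
rewrite -/(horner_eval 0 _) lminor_rmorph /=.
have /= <- := lminor_scale_rows k (fun i => (t (k - i)%N).[0]) (fun i j => kappa (k - i)%N ^+ j).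
apply: eq_lminor => i j ik _; rewrite /horner_eval /qentry hornerZ horner_dilate mulr0 mulrC.
by congr ((t _).[_] * kappa _ ^+ _); rewrite /qrow; case: i ik => *; lia.
Qed.

Lemma Vandermonde_neq0 k : (k <= N)%N ->
  (forall i j, (0 < i <= N)%N -> (0 < j <= N)%N -> i <> j -> kappa i != kappa j) ->
  \det (Vandermonde k (\row_(i < k) kappa (k - i)%N)) != 0.
Proof.
move=> kN kd; rewrite det_Vandermonde.
apply/prodf_neq0 => i _; apply/prodf_neq0 => j ij; rewrite !mxE subr_eq0.
by apply: kd; have := ltn_ord i; have := ltn_ord j; lia.
Qed.
End QWronskian.

(** * Equivalence of the Bethe equations and the q-oper equations *)

Section OperEquations.
Variables (C : fieldType) (q qh : C) (N L : nat) (z : 'I_L -> C) (l : 'I_L -> nat -> nat).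
Variables (kappa : nat -> C).
Hypotheses (q0 : q != 0) (qhE : qh ^+ 2 = q) (q_nroot : not_root_of_unity q).
Hypothesis z_neq0 : forall m : 'I_L, z m != 0.
Hypothesis kappa_neq0 : forall i : nat, (0 < i <= N)%N -> kappa i != 0.
Hypothesis kappa_disj : forall i j : nat, (0 < i <= N)%N -> (0 < j <= N)%N ->
  i <> j -> disjoint_lattices q (kappa i) (kappa j).

Let W := Wpoly q z l.

Lemma kappa_ratio i j (n : int) : (0 < i <= N)%N -> (0 < j <= N)%N ->
  i <> j -> kappa i != kappa j * q ^ n.
Proof.
by move=> iN jN ij; have := kappa_disj iN jN ij 0 n; rewrite expr0z mul1r mulrC.
Qed.

Lemma kappa_distinct i j : (0 < i <= N)%N -> (0 < j <= N)%N ->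
  i <> j -> kappa i != kappa j.
Proof. by move=> iN jN ij; have := kappa_ratio 0 iN jN ij; rewrite expr0z mulr1. Qed.

(** The empty determinant is 1, which completes the q-oper equations by k = 0. *)
Definition with_one_at0 (al : nat -> C) (k : nat) : C := if k is 0%N then 1 else al k.

Lemma with_one_at0_neq0 al k :
  (forall k : nat, (0 < k <= N)%N -> al k != 0) -> (k <= N)%N -> with_one_at0 al k != 0.
Proof. by move=> al0; case: k => [|k] kN; [rewrite oner_eq0 | apply: al0]. Qed.

Lemma Vpoly0 v : Vpoly N v 0 = 1 :> {poly C}.
Proof. by rewrite /Vpoly big_nil. Qed.

Lemma VpolyN v : Vpoly N v N = 1 :> {poly C}.
Proof. by rewrite /Vpoly /level ltnn andbF big_nil. Qed.

Lemma qoper_equationsE al s v :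
  qoper_equations q N z l kappa al s v <->
  (forall k, (k <= N)%N -> casorati q kappa (rev_index N s) k k =
     with_one_at0 al k *: (W k * Vpoly N v k)).
Proof.
split=> [e [|k] kN|e k /andP[k0 kN]].
- by rewrite casorati0 /W Wpoly0 Vpoly0 mulr1 scale1r.
- by rewrite -qwronskianE // e.
- by rewrite qwronskianE // e //; case: k k0 {kN}.
Qed.

(** If V_k vanishes at 0, then so does some s_i, hence also the full determinant,
    which is a multiple of W_N. *)
Lemma qoper_roots_neq0 al s v :
  (forall k : nat, (0 < k <= N)%N -> al k != 0) ->
  qoper_equations q N z l kappa al s v ->
  forall k y, y \in level N v k -> y != 0.
Proof.
move=> al0 /qoper_equationsE e k y yk.
have [kN _] := mem_level yk.
have t0 i : (i < N)%N -> (rev_index N s (N - i)%N).[0] != 0.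
  have := congr1 (fun p => p.[0]) (e N (leqnn N)).
  rewrite /= casorati_at0 VpolyN mulr1 hornerZ => eN iN.
  have : with_one_at0 al N * (W N).[0] != 0.
    by rewrite mulf_neq0 ?with_one_at0_neq0 ?Wpoly_at0_neq0.
  rewrite -eN mulf_eq0 negb_or => /andP[/prodf_neq0 /(_ (Ordinal iN) isT)] //.
apply/negP => /eqP y0; have := congr1 (fun p => p.[0]) (e k ltac:(lia)).
rewrite /= casorati_at0 hornerZ hornerM.
have -> : (Vpoly N v k).[0] = 0.
  by apply/rootP; rewrite root_prod_XsubC -{1}y0.
rewrite !mulr0; apply/eqP; rewrite mulf_neq0 //.
  apply/prodf_neq0 => i _; have ik := ltn_ord i.
  by have := t0 (N - (k - i))%N; rewrite subKn; [apply; lia | lia].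
by apply: (@Vandermonde_neq0 _ N) => [|i j]; [lia | exact: kappa_distinct].
Qed.

Lemma qoper_bethe al s u :
  roots_nondegenerate q N z (rescale qh u) ->
  (forall k : nat, (0 < k <= N)%N -> al k != 0) ->
  qoper_equations q N z l kappa al s (rescale qh u) ->
  bethe_solution q qh N z l kappa u.
Proof.
move=> nd al0 eqs; apply/bethe_solutionP => //.
split=> [k y yk|k y kN yk]; first exact: (qoper_roots_neq0 al0 eqs yk).
have e := (qoper_equationsE al s _).1 eqs.
apply: (casorati_bethe q0 (N := N) (W := W) kappa_neq0 _
  (fun k => with_one_at0_neq0 (k := k) al0) e kN yk).
  by move=> m; exact: Wpoly_rec.
by apply: Wpoly_lattice_neq0 => // m; exact: (level_disjoint_z nd m yk).
Qed.

Lemma bethe_qoper al u :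
  roots_nondegenerate q N z (rescale qh u) ->
  (forall k : nat, (0 < k <= N)%N -> al k != 0) ->
  bethe_solution q qh N z l kappa u ->
  exists2 s, qoper_equations q N z l kappa al s (rescale qh u) &
    forall m p, (0 < m <= p)%N -> (p <= N)%N ->
      W m %| casorati q kappa (rev_index N s) p m.
Proof.
move=> nd al0 /bethe_solutionP [] // y0 rel.
have [||m|||k|k x n xk n0|k x n|k x|t [tE tW]] := @casorati_exists_upto _ q kappa N
  (level N (rescale qh u)) W (Lambda_shift q z l) q0 kappa_neq0
  (fun i j n => @kappa_ratio i j n) _ _ (fun k => Wpoly_neq0 z l q0 k) _ _
  (with_one_at0 al) (fun k => with_one_at0_neq0 (k := k) al0) _ _ _ _ _ N (leqnn N).
- exact: Wpoly0.
- exact: Wpoly1.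
- exact: Wpoly_rec.
- by [].
- by [].
- exact: (level_uniq nd).
- by apply: (level_shift q_nroot nd) => //; exact: y0 xk.
- exact: (level_next nd).
- exact: rel.
exists (fun i => t (N.+1 - i)%N).
  apply/qoper_equationsE => k kN; rewrite -tE //.
  case: k kN => [|k] kN; first by rewrite !casorati0.
  apply: eq_casorati; rewrite // /rev_index ?subKn //; first by lia.
  by move=> i ik; rewrite subKn //; lia.
move=> m p mp pN; rewrite (@eq_casorati _ _ _ _ t) ?tW //; first by lia.
  by rewrite /rev_index subKn //; lia.
by move=> i im; rewrite /rev_index subKn //; lia.
Qed.

Lemma casorati_scale (c : nat -> C) (t : nat -> {poly C}) p m :
  casorati q kappa (fun i => c i *: t i) p m =
  (\prod_(i < m) c (qrow p m i)) *: casorati q kappa t p m.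
Proof.
rewrite -mul_polyC rmorph_prod /=.
rewrite -(lminor_scale_rows m (fun i => (c (qrow p m i))%:P)).
apply: eq_lminor => i j _ _.
by rewrite /qentry linearZ /= mul_polyC !scalerA mulrC.
Qed.

(** Multiplying t_p by c_p multiplies D_k by c_1 ... c_k. So t can be rescaled to
    have the same determinants as t', and casorati_unique applies. *)
Lemma qoper_sections_unique al al' s s' v :
  (forall k : nat, (0 < k <= N)%N -> al k != 0) ->
  (forall k : nat, (0 < k <= N)%N -> al' k != 0) ->
  qoper_equations q N z l kappa al s v ->
  qoper_equations q N z l kappa al' s' v ->
  exists c : nat -> C, forall i, (0 < i <= N)%N -> c i != 0 /\ s' i = c i *: s i.
Proof.
move=> al0 al0' /qoper_equationsE e /qoper_equationsE e'.
have b0 := fun k => with_one_at0_neq0 (k := k) al0.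
have b0' := fun k => with_one_at0_neq0 (k := k) al0'.
pose be k := with_one_at0 al' k / with_one_at0 al k.
have be0 k : (k <= N)%N -> be k != 0.
  by move=> kN; rewrite mulf_neq0 ?invr_neq0 ?b0 ?b0'.
pose c p := be p / be p.-1.
have prod_c k : (k <= N)%N -> \prod_(i < k) c (qrow k k i) = be k.
  elim: k => [|k IH] kN; first by rewrite big_ord0 /be /= divr1.
  rewrite big_ord_recl /= -[RHS](divfK (be0 k (ltnW kN))); congr (_ * _).
  rewrite -IH ?(ltnW kN) //; apply: eq_bigr => i _; congr c.
  by rewrite /qrow /= /bump; have := ltn_ord i; case: (nat_of_ord i) => *; lia.
have D0 k : (k <= N)%N -> casorati q kappa (rev_index N s') k k != 0.
  move=> kN; rewrite e' // scaler_eq0 negb_or b0' // mulf_neq0 ?Wpoly_neq0 //.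
  by rewrite monic_neq0 ?monic_prod_XsubC.
have same k : (k <= N)%N -> casorati q kappa (rev_index N s') k k =
    casorati q kappa (fun i => c i *: rev_index N s i) k k.
  by move=> kN; rewrite casorati_scale prod_c // e' // e // scalerA /be divfK ?b0.
have u := casorati_unique q0 kappa_neq0 (fun i j n => @kappa_ratio i j n) D0 same.
exists (fun i => c (N.+1 - i)%N) => i iN; split.
  by rewrite mulf_neq0 ?invr_neq0 ?be0 //; lia.
have := u (N.+1 - i)%N ltac:(lia).
by rewrite /rev_index subKn //; lia.
Qed.
End OperEquations.

(** * Triangular reduction of polynomial matrices *)

Lemma unitmx_morph (R S : comUnitRingType) (f : {rmorphism R -> S}) n (A : 'M[R]_n) :
  A \in unitmx -> map_mx f A \in unitmx.
Proof.
move=> uA; have := congr1 (map_mx f) (mulmxV uA).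
by rewrite map_mxM map_mx1 => /mulmx1_unit[].
Qed.

Section Hermite.
Variable F : fieldType.

Lemma unitmx_elementary n (i j : 'I_n) (a : {poly F}) : i != j ->
  1%:M - a *: delta_mx i j \in unitmx.
Proof.
move=> ij; suff e : (1%:M - a *: delta_mx i j) *m (1%:M + a *: delta_mx i j) = 1%:M.
  by have [] := mulmx1_unit e.
rewrite mulmxBl mul1mx mulmxDr mulmx1 -scalemxAl -scalemxAr mul_delta_mx_0 1?eq_sym //.
by rewrite !scaler0 addr0 addrK.
Qed.

(** Euclid's algorithm: as long as some entry is not divisible by the first one,
    its remainder replaces the first entry and has smaller degree. *)
Lemma column_reduction n (c : 'cV[{poly F}]_(1 + n)) :
  exists2 P : 'M[{poly F}]_(1 + n), P \in unitmx & dsubmx (P *m c) = 0.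
Proof.
have [->|c0] := eqVneq c 0; first by exists 1%:M; rewrite ?unitmx1 // mul1mx linear0.
wlog: c {c0} / c ord0 0 != 0.
  have [i ci] : exists i, c i 0 != 0.
    apply/existsP; apply: contraNT c0; rewrite negb_exists => /forallP c0.
    by apply/eqP/matrixP=> i j; rewrite ord1 mxE; apply/eqP; rewrite -[_ == _]negbK.
  case/(_ (xrow ord0 i c)); first by rewrite mxE tpermL.
  move=> P uP E; exists (P *m tperm_mx ord0 i); first by rewrite unitmx_mul uP unitmx_perm.
  by rewrite -mulmxA -xrowE.
have [k ck] := ubnP (size (c ord0 0)).
elim: k c ck => // k IH c; rewrite ltnS => ck c0.
have [dv|] := boolP [forall i : 'I_n, c ord0 0 %| c (rshift 1 i) 0].
  pose w : 'M[{poly F}]_(n, 1) := \col_i (c (rshift 1 i) 0 %/ c ord0 0).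
  exists (block_mx 1%:M 0 (- w) 1%:M); first by rewrite unitmxE det_lblock !det1 mulr1 unitr1.
  rewrite -[c]vsubmxK mul_block_col col_mxKd mul1mx mulNmx; apply/matrixP=> i j.
  rewrite !mxE big_ord1 !mxE (ord1 j).
  have -> : lshift n (0 : 'I_1) = ord0 by apply: val_inj.
    by rewrite divpK ?addNr //; move/forallP: dv.
rewrite negb_forall => /existsP[i ndv].
set i' := rshift 1 i in ndv.
have ne : i' != ord0 :> 'I_(1 + n) by [].
pose a := c i' 0 %/ c ord0 0.
pose E := 1%:M - a *: delta_mx i' ord0 : 'M[{poly F}]_(1 + n).
have rem : (xrow ord0 i' (E *m c)) ord0 0 = c i' 0 %% c ord0 0.
  rewrite mxE tpermL mulmxBl mul1mx -scalemxAl !mxE (bigD1 ord0) //= mxE !eqxx mul1r.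
  rewrite big1 ?addr0; last by move=> j j0; rewrite mxE (negPf j0) andbF mul0r.
  by rewrite {1}(divp_eq (c i' 0) (c ord0 0)) addrAC subrr add0r.
have [||P uP PE] := IH (xrow ord0 i' (E *m c)).
- by rewrite rem; apply: leq_trans ck; rewrite ltn_modp.
- by rewrite rem.
exists (P *m (tperm_mx ord0 i' *m E)).
  by rewrite !unitmx_mul uP unitmx_perm unitmx_elementary.
by rewrite -!mulmxA -xrowE.
Qed.

(** Clear the first column and recurse on the lower right block. If M is
    nonsingular, the columns of P are a basis of F[z]^n adapted to the flag that
    the columns of M span. *)
Lemma hermite_form n (M : 'M[{poly F}]_n) :
  exists P H : 'M[{poly F}]_n, [/\ P \in unitmx, M = P *m H &
    forall i j : 'I_n, (j < i)%N -> H i j = 0].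
Proof.
elim: n M => [|n IH] M.
  by exists 1%:M, M; split; rewrite ?unitmx1 ?mul1mx // => -[].
move: M; rewrite -[n.+1]/(1 + n)%N => M.
have [P uP PE] := column_reduction (lsubmx M).
have [Q [H [uQ QE tri]]] := IH (drsubmx (P *m M)).
pose B := block_mx 1%:M 0 0 Q : 'M_(1 + n).
have uB : B \in unitmx by rewrite unitmxE det_ublock det1 mul1r -unitmxE.
pose T := block_mx (ulsubmx (P *m M)) (ursubmx (P *m M)) 0 H : 'M_(1 + n).
exists (invmx P *m B), T; split.
- by rewrite unitmx_mul unitmx_inv uP.
- have PM : P *m M = B *m T.
    rewrite mulmx_block !mul1mx !mul0mx !mulmx0 !addr0 !add0r -QE -[LHS]submxK.
    congr block_mx; rewrite -PE.
    have -> : P *m lsubmx M = lsubmx (P *m M).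
      by rewrite -[in RHS](hsubmxK M) mul_mx_row row_mxKl.
    by apply/matrixP=> i j; rewrite !mxE.
  by rewrite -mulmxA -PM mulKmx.
- move=> i j ji; rewrite /T.
  case: (split_ordP i) ji => i' ->; case: (split_ordP j) => j' -> /=.
  + by rewrite !ord1.
  + by rewrite ord1.
  + by rewrite block_mxEdl mxE.
  + by rewrite block_mxEdr ltn_add2l; apply: tri.
Qed.
End Hermite.

(** * Pullback on C(z) and flags spanned by columns *)

Lemma sub_fractions (K : fieldType) (a b a' b' : K) : b != 0 -> b' != 0 ->
  a / b - a' / b' = (a * b' - a' * b) / (b * b').
Proof. by move=> b0 b0'; field; rewrite b0 b0'. Qed.

Section QPull.
Variables (C : fieldType) (q : C).
Hypothesis q0 : q != 0.
Local Notation tofrac := (@FracField.tofrac {poly C}).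

Lemma frac_quotient (x : ratfun C) :
  exists n d : {poly C}, d != 0 /\ x = tofrac n / tofrac d.
Proof.
exists \n_(repr x), \d_(repr x); split; first exact: denom_ratioP.
by rewrite -frac_numden reprK.
Qed.

Lemma qpull_tofrac (p : {poly C}) : qpull q (tofrac p) = tofrac (dilate q p).
Proof.
have := qpull_frac p q0 (oner_neq0 {poly C}).
by rewrite (rmorph1 (dilate q)) !tofrac1 !divr1.
Qed.

Fact qpull_is_zmod_morphism : zmod_morphism (qpull q).
Proof.
move=> x y; have [n [d [d0 ->]]] := frac_quotient x.
have [m [e [e0 ->]]] := frac_quotient y.
have sub (a b a' b' : {poly C}) : b != 0 -> b' != 0 ->
    tofrac a / tofrac b - tofrac a' / tofrac b' = tofrac (a * b' - a' * b) / tofrac (b * b').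
  move=> b0 b0'; rewrite !(rmorphB, rmorphM) /=.
  by apply: sub_fractions; rewrite tofrac_eq0.
by rewrite sub // !qpull_frac ?mulf_neq0 // sub ?dilate_eq0 // !(rmorphB, rmorphM).
Qed.

Fact qpull_is_monoid_morphism : monoid_morphism (qpull q).
Proof.
split; first by rewrite -tofrac1 qpull_tofrac rmorph1.
move=> x y; have [n [d [d0 ->]]] := frac_quotient x.
have [m [e [e0 ->]]] := frac_quotient y.
have mul (a b a' b' : {poly C}) :
    tofrac a / tofrac b * (tofrac a' / tofrac b') = tofrac (a * a') / tofrac (b * b').
  by rewrite !rmorphM /= invfM mulrACA.
by rewrite mul !qpull_frac ?mulf_neq0 // mul !rmorphM.
Qed.

Definition qpull_rmorphism : {rmorphism ratfun C -> ratfun C} :=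
  HB.pack (qpull q)
    (GRing.isZmodMorphism.Build _ _ (qpull q) qpull_is_zmod_morphism)
    (GRing.isMonoidMorphism.Build _ _ (qpull q) qpull_is_monoid_morphism).

Lemma map_qpullM m n p (A : 'M[ratfun C]_(m, n)) (B : 'M_(n, p)) :
  map_mx (qpull q) (A *m B) = map_mx (qpull q) A *m map_mx (qpull q) B.
Proof. exact: (map_mxM qpull_rmorphism). Qed.

Lemma map_qpull_polmx m n (A : 'M[{poly C}]_(m, n)) :
  map_mx (qpull q) (polmx A) = polmx (map_mx (dilate q) A).
Proof. by apply/matrixP=> i j; rewrite !mxE qpull_tofrac. Qed.

End QPull.

Lemma qpullK (C : fieldType) (q : C) : q != 0 -> cancel (qpull q^-1) (qpull q).
Proof.
move=> q0 x; have [n [d [d0 ->]]] := frac_quotient x.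
have q0' : q^-1 != 0 by rewrite invr_eq0.
rewrite (qpull_frac n q0' d0) qpull_frac ?dilate_eq0 //.
by rewrite !dilateM mulfV // !dilate1.
Qed.

Lemma map_qpullK (C : fieldType) (q : C) m n (A : 'M[ratfun C]_(m, n)) : q != 0 ->
  map_mx (qpull q) (map_mx (qpull q^-1) A) = A.
Proof. by move=> q0; apply/matrixP=> i j; rewrite !mxE qpullK. Qed.

Lemma polmxM (C : fieldType) m n p (A : 'M[{poly C}]_(m, n)) (B : 'M_(n, p)) :
  polmx (A *m B) = polmx A *m polmx B.
Proof. exact: map_mxM. Qed.

Lemma polmx_inj (C : fieldType) m n : injective (@polmx C m n).
Proof.
move=> A B e; apply/matrixP=> i j; apply/eqP; rewrite -tofrac_eq.
by have /matrixP/(_ i j) := e; rewrite !mxE => ->.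
Qed.

Lemma polmx_unit (C : fieldType) n (A : 'M[{poly C}]_n) :
  (polmx A \in unitmx) = (\det A != 0).
Proof. by rewrite unitmxE /polmx det_map_mx unitfE tofrac_eq0. Qed.

Lemma unitmx_det_neq0 (R : comUnitRingType) n (A : 'M[R]_n) :
  A \in unitmx -> \det A != 0.
Proof. by rewrite unitmxE; apply: contraTneq => ->; rewrite unitr0. Qed.

Section ColumnSpan.
Variables (K : fieldType) (N : nat).
Implicit Types (M : 'M[K]_N) (w : 'cV[K]_N).

Definition colspan M (k : nat) : {vspace 'cV[K]_N} :=
  (\sum_(j < N | (j < k)%N) <[col j M]>)%VS.

Lemma mulmx_sum_cols M (y : 'cV[K]_N) : M *m y = \sum_j y j 0 *: col j M.
Proof.
apply/matrixP=> i j; rewrite mxE summxE; apply: eq_bigr => k _.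
by rewrite !mxE ord1 mulrC.
Qed.

Lemma mem_colspan M k w :
  w \in colspan M k <->
  exists2 y : 'cV[K]_N, (forall j : 'I_N, (k <= j)%N -> y j 0 = 0) & w = M *m y.
Proof.
split=> [/memv_sumP[vs vsM ->]|[y y0 ->]].
  have /fin_all_exists[c cE] (j : 'I_N) :
      exists a : K, (if (j < k)%N then vs j = a *: col j M else a = 0).
    have [jk|jk] := boolP (j < k)%N; last by exists 0.
    by have /vlineP[a ->] := vsM j jk; exists a.
  exists (\col_j c j) => [j kj|]; first by rewrite mxE; have := cE j; rewrite ltnNge kj.
  rewrite mulmx_sum_cols [RHS](bigID (fun j : 'I_N => (j < k)%N)) /= [X in _ + X]big1 ?addr0.
    by apply: eq_bigr => j jk; rewrite mxE; have := cE j; rewrite jk.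
  by move=> j jk; rewrite mxE; have := cE j; rewrite (negPf jk) => ->; rewrite scale0r.
apply/memv_sumP; exists (fun j => y j 0 *: col j M).
  by move=> j _; rewrite memvZ // memv_line.
rewrite mulmx_sum_cols (bigID (fun j : 'I_N => (j < k)%N)) /= [X in _ + X]big1 ?addr0 //.
by move=> j jk; rewrite y0 ?scale0r // leqNgt.
Qed.

Lemma col_colspan M k (j : 'I_N) : (j < k)%N -> col j M \in colspan M k.
Proof.
move=> jk; apply/mem_colspan; exists (delta_mx j 0); last by rewrite colE.
by move=> i ki; rewrite mxE; case: eqP => // ij; move: jk; rewrite -ij ltnNge ki.
Qed.

Lemma colspan_sub M (U : {vspace 'cV[K]_N}) k :
  (forall j : 'I_N, (j < k)%N -> col j M \in U) -> (colspan M k <= U)%VS.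
Proof. by move=> jU; apply/subv_sumP => j jk; rewrite -memvE jU. Qed.

Lemma colspanS M (k : 'I_N) : colspan M k.+1 = (colspan M k + <[col k M]>)%VS.
Proof.
rewrite /colspan (bigD1 k) //= addvC; congr (_ + _)%VS; apply: eq_bigl => j.
by rewrite ltnS [in RHS]ltn_neqAle andbC.
Qed.

(** The dimension grows by at most one at each of the N steps from 0 to N. *)
Lemma dim_colspan M k : M \in unitmx -> (k <= N)%N -> \dim (colspan M k) = k.
Proof.
move=> uM kN.
have step j : (j < N)%N -> (\dim (colspan M j.+1) <= (\dim (colspan M j)).+1)%N.
  move=> jN; rewrite (colspanS M (Ordinal jN)).
  apply: leq_trans (dimv_add_leqif _ _).1 _.
  by rewrite -[X in (_ <= X)%N]addn1 leq_add2l dim_vline leq_b1.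
have up j : (j <= N)%N -> (\dim (colspan M j) <= j)%N.
  elim: j => [|j IH] jN; first by rewrite /colspan big_pred0 ?dimv0.
  by apply: leq_trans (step j jN) _; rewrite ltnS IH // ltnW.
have full : \dim (colspan M N) = N.
  have -> : colspan M N = fullv.
    apply/eqP; rewrite eqEsubv subvf /=; apply/subvP => w _; apply/mem_colspan.
    exists (invmx M *m w) => [j|]; first by rewrite leqNgt ltn_ord.
    by rewrite mulKVmx.
  by rewrite dimvf /dim /= muln1.
have down i : (i <= N)%N -> (N <= \dim (colspan M (N - i)) + i)%N.
  elim: i => [|i IH] iN; first by rewrite subn0 addn0 full.
  apply: leq_trans (IH (ltnW iN)) _.
  have := step (N - i.+1)%N; rewrite -subSn // subSS => /(_ ltac:(lia)); lia.
by have := up k kN; have := down (N - k)%N; rewrite subKn //; lia.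
Qed.

Lemma colspan_eq M (U : {vspace 'cV[K]_N}) k : M \in unitmx -> (k <= N)%N ->
  \dim U = k -> (forall j : 'I_N, (j < k)%N -> col j M \in U) -> colspan M k = U.
Proof.
move=> uM kN dU jU; apply/eqP; rewrite eqEdim colspan_sub //=.
by rewrite dU dim_colspan.
Qed.
End ColumnSpan.

Lemma colspan_mul (K : fieldType) N (g M : 'M[K]_N) k w :
  g \in unitmx -> (g *m w \in colspan (g *m M) k) = (w \in colspan M k).
Proof.
move=> ug; apply/idP/idP => /mem_colspan[y y0 e]; apply/mem_colspan; exists y => //.
  by rewrite -(mulKmx ug w) e -mulmxA mulKmx.
by rewrite e mulmxA.
Qed.

(** * The q-oper generated by a section *)

Lemma in_qpullP (C : fieldType) (q : C) N (U : {vspace 'cV[ratfun C]_N}) w : q != 0 ->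
  in_qpull q U w <-> map_mx (qpull q^-1) w \in U.
Proof.
move=> q0; have qV0 : q^-1 != 0 by rewrite invr_eq0.
split=> [[w' wU ->]|wU]; last by exists (map_mx (qpull q^-1) w); rewrite ?map_qpullK.
by have := map_qpullK w' qV0; rewrite invrK => ->.
Qed.

Section CyclicMatrix.
Variables (C : fieldType) (q : C) (N : nat) (kappa : nat -> C).
Hypothesis kappa_neq0 : forall i : nat, (0 < i <= N)%N -> kappa i != 0.
Implicit Types s : nat -> {poly C}.

Lemma zeta_neq0 (i : 'I_N) : zeta N kappa i.+1 != 0.
Proof. by apply: kappa_neq0; have := ltn_ord i; lia. Qed.

Definition Zinv : 'M[{poly C}]_N := map_mx polyC (invmx (Zmx N kappa)).

(** The iterates s(z), Z^-1 s(z/q), Z^-2 s(z/q^2), ... of s under the connection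
    Z^-1. *)
Definition cyclic_mx s : 'M[{poly C}]_N :=
  \matrix_(i, j) (zeta N kappa i.+1 ^- j *: dilate (q ^- j) (s i.+1)).

Lemma invmx_Zmx : invmx (Zmx N kappa) = diag_mx (\row_(i < N) (zeta N kappa i.+1)^-1).
Proof.
have e : Zmx N kappa *m diag_mx (\row_(i < N) (zeta N kappa i.+1)^-1) = 1%:M.
  rewrite mulmx_diag; apply/matrixP=> i j; rewrite !mxE.
  by rewrite mulfV // zeta_neq0.
have [uZ _] := mulmx1_unit e.
by rewrite -[LHS]mulmx1 -e mulKmx.
Qed.

Lemma det_Zmx : \prod_(1 <= i < N.+1) kappa i = 1 -> \det (Zmx N kappa) = 1.
Proof.
move=> <-; rewrite det_diag big_add1 /= big_mkord (reindex_inj rev_ord_inj) /=.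
by apply: eq_bigr => i _; rewrite mxE /zeta /=; congr kappa; have := ltn_ord i; lia.
Qed.

Lemma ZinvE i j : Zinv i j = ((zeta N kappa (nat_of_ord i).+1)^-1)%:P *+ (i == j).
Proof. by rewrite mxE invmx_Zmx !mxE rmorphMn. Qed.

Lemma mul_Zinv n (M : 'M[{poly C}]_(N, n)) i j :
  (Zinv *m M) i j = (zeta N kappa (nat_of_ord i).+1)^-1 *: M i j.
Proof.
rewrite mxE (bigD1 i) //= big1 ?addr0; first by rewrite ZinvE eqxx mul_polyC.
by move=> k ki; rewrite ZinvE eq_sym (negPf ki) mul0r.
Qed.

Hypothesis q0 : q != 0.

Lemma Zinv_cyclic_mx s (j j' : 'I_N) : nat_of_ord j' = j.+1 ->
  Zinv *m col j (cyclic_mx s) = map_mx (dilate q) (col j' (cyclic_mx s)).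
Proof.
move=> jj; apply/matrixP=> i k; rewrite mul_Zinv !mxE dilateZ dilateM jj scalerA.
by rewrite !exprS !invfM mulVKf.
Qed.

(** Dilating by q^(N-1) and clearing the twists turns the columns into those of
    the Casorati determinant, in the opposite order. *)
Lemma det_cyclic_mx s : exists2 c : C, c != 0 &
  dilate (q ^+ N.-1) (\det (cyclic_mx s)) = c *: casorati q kappa (fun p => s (N.+1 - p)%N) N N.
Proof.
set t := (fun p => s (N.+1 - p)%N).
pose A := \matrix_(i < N, j < N) qentry q kappa t (qrow N N i) j.
pose r := perm (@rev_ord_inj N).
pose D := \row_(i < N) (zeta N kappa i.+1 ^- N.-1)%:P.
have e : map_mx (dilate (q ^+ N.-1)) (cyclic_mx s) = diag_mx D *m col_perm r A.
  rewrite mul_diag_mx; apply/matrixP=> i j; rewrite !mxE permE /qentry.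
  have -> : qrow N N i = (N - i)%N by rewrite /qrow; case: (nat_of_ord i) => *; lia.
  have iN := ltn_ord i; have jN := ltn_ord j.
  have -> : t (N - i)%N = s i.+1 by rewrite /t; congr s; lia.
  have -> : kappa (N - i)%N = zeta N kappa i.+1 by rewrite /zeta; congr kappa; lia.
  have Nj : N.-1 = (j + (N - j.+1))%N by lia.
  rewrite dilateZ dilateM mul_polyC scalerA /= Nj; congr (_ *: dilate _ _).
    by rewrite exprD invfM mulfVK // expf_neq0 // zeta_neq0.
    by rewrite exprD mulrAC mulfV ?mul1r // expf_neq0.
exists ((\prod_(i < N) zeta N kappa i.+1 ^- N.-1) * (-1) ^+ r).
  rewrite mulf_neq0 ?signr_eq0 //; apply/prodf_neq0 => i _.
  by rewrite invr_eq0 expf_neq0 // zeta_neq0.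
rewrite -det_map_mx e det_mulmx det_diag col_permE det_mulmx det_perm odd_permV.
have -> : \prod_i D 0 i = (\prod_(i < N) zeta N kappa i.+1 ^- N.-1)%:P.
  by rewrite rmorph_prod; apply: eq_bigr => i _; rewrite mxE.
rewrite /casorati /lminor -/A -mul_polyC polyCM rmorph_sign -!mulrA.
by congr (_ * _); rewrite mulrC.
Qed.

Definition cyclic_oper s : qflagged C N :=
  QFlagged (cstmx (invmx (Zmx N kappa))) (colspan (polmx (cyclic_mx s))).

Lemma polmx_col m (M : 'M[{poly C}]_(m, N)) j : polmx (col j M) = col j (polmx M).
Proof. by apply/matrixP=> a b; rewrite !mxE. Qed.

Lemma col0_cyclic_mx (N_gt0 : (0 < N)%N) s :
  col (Ordinal N_gt0) (cyclic_mx s) = \col_(i < N) s i.+1.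
Proof. by apply/matrixP=> i j; rewrite !mxE !expr0 !invr1 dilate1 scale1r. Qed.

Lemma qpullV_Zinv_cyclic_mx s (j j' : 'I_N) : nat_of_ord j' = j.+1 ->
  map_mx (qpull q^-1) (polmx Zinv *m col j (polmx (cyclic_mx s))) = col j' (polmx (cyclic_mx s)).
Proof.
move=> jj; have qV0 : q^-1 != 0 by rewrite invr_eq0.
rewrite -polmx_col -polmxM (Zinv_cyclic_mx s jj) -map_qpull_polmx // polmx_col.
by have := map_qpullK (col j' (polmx (cyclic_mx s))) qV0; rewrite invrK.
Qed.

Lemma cyclic_oper_flag_map s i w : (i < N)%N -> w \in colspan (polmx (cyclic_mx s)) i ->
  in_qpull q (colspan (polmx (cyclic_mx s)) i.+1) (polmx Zinv *m w).
Proof.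
move=> iN /mem_colspan[y y0 ->]; apply/in_qpullP => //.
have qV0 : q^-1 != 0 by rewrite invr_eq0.
rewrite mulmx_sum_cols mulmx_sumr.
rewrite [map_mx _ _](_ : _ = \sum_j qpull q^-1 (y j 0) *:
    map_mx (qpull q^-1) (polmx Zinv *m col j (polmx (cyclic_mx s)))); last first.
  rewrite -[LHS]/(map_mx (qpull_rmorphism qV0) _) raddf_sum /=.
  by apply: eq_bigr => j _; rewrite -scalemxAr; exact: (map_mxZ (qpull_rmorphism qV0)).
apply: memv_suml => j _; have [ji|ij] := ltnP j i; last first.
  by rewrite y0 // -[qpull _ _]/(qpull_rmorphism qV0 0) rmorph0 scale0r mem0v.
have j'N : (j.+1 < N)%N by apply: leq_trans iN.
by rewrite memvZ // (@qpullV_Zinv_cyclic_mx s j (Ordinal j'N)) // col_colspan.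
Qed.
End CyclicMatrix.

(** * The frame of the generated flag *)

Section Degrees.
Variable C : fieldType.
Implicit Types p r : {poly C}.

Lemma degM p r : p != 0 -> r != 0 -> (size (p * r)).-1 = ((size p).-1 + (size r).-1)%N.
Proof.
move=> p0 r0; rewrite size_mul //.
move: p0 r0; rewrite -!size_poly_gt0.
by case: (size p) (size r) => [|a] [|b] // _ _; rewrite addSn addnS.

Qed.

Lemma deg_prod n (F : 'I_n -> {poly C}) : (forall i, F i != 0) ->
  (size (\prod_i F i)).-1 = (\sum_i (size (F i)).-1)%N.
Proof.
elim: n F => [|n IH] F F0; first by rewrite !big_ord0 size_poly1.
by rewrite !big_ord_recl degM ?IH //; apply/prodf_neq0.
Qed.

Lemma deg_const p : p != 0 -> (size p).-1 = 0%N -> exists2 c : C, c != 0 & p = c%:P.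
Proof.
move=> p0 dp; have sp : (size p <= 1)%N by rewrite -subn_eq0 subn1 dp.
exists p`_0; last exact: size1_polyC.
by apply: contraNneq p0 => e; rewrite (size1_polyC sp) e.
Qed.

Lemma coprimep_prod_XsubC p (s : seq C) : (forall x, x \in s -> ~~ root p x) ->
  coprimep p (\prod_(x <- s) ('X - x%:P)).
Proof.
elim: s => [|a s IH] ps; first by rewrite big_nil coprimep1.
rewrite big_cons coprimepMr coprimep_XsubC ps ?mem_head //=.
by apply: IH => x xs; apply: ps; rewrite inE xs orbT.
Qed.

Lemma unitmx_poly_det n (A : 'M[{poly C}]_n) : A \in unitmx ->
  exists2 c : C, c != 0 & \det A = c%:P.
Proof.
rewrite unitmxE poly_unitE => /andP[/eqP sA cA].
exists (\det A)`_0; first by rewrite unitfE in cA.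
by apply: size1_polyC; rewrite sA.
Qed.
End Degrees.

Section Frame.
Variables (C : fieldType) (q : C) (N : nat) (kappa : nat -> C) (s : nat -> {poly C}).
Hypothesis q0 : q != 0.
Hypothesis kappa_neq0 : forall i : nat, (0 < i <= N)%N -> kappa i != 0.
Variables (B H : 'M[{poly C}]_N).
Hypothesis uB : B \in unitmx.
Hypothesis cyclic_mxE : cyclic_mx q N kappa s = B *m H.
Hypothesis tri : forall i j : 'I_N, (j < i)%N -> H i j = 0.
Hypothesis det0 : \det (cyclic_mx q N kappa s) != 0.

Lemma det_triangular : \det H = \prod_i H i i.
Proof.
rewrite -det_tr det_trig; first by apply: eq_bigr => i _; rewrite mxE.
by apply/is_trig_mxP => i j ij; rewrite mxE tri.
Qed.

Lemma diag_neq0 i : H i i != 0.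
Proof.
have : \det H != 0 by apply: contraNneq det0 => e; rewrite cyclic_mxE det_mulmx e mulr0.
by rewrite det_triangular => /prodf_neq0; apply.
Qed.

Lemma polmx_cyclic_mx_unit : polmx (cyclic_mx q N kappa s) \in unitmx.
Proof. by rewrite polmx_unit. Qed.

Lemma colspan_frame k : (k <= N)%N ->
  colspan (polmx (cyclic_mx q N kappa s)) k = colspan (polmx B) k.
Proof.
move=> kN; have uB' : polmx B \in unitmx by rewrite polmx_unit unitmx_det_neq0.
refine (colspan_eq polmx_cyclic_mx_unit kN (dim_colspan uB' kN) _) => j jk.
apply/mem_colspan; exists (polmx (col j H)).
  by move=> i ki; rewrite !mxE tri ?tofrac0 //; apply: leq_trans ki.
by rewrite -polmx_col cyclic_mxE -polmxM !colE mulmxA.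
Qed.

(** The matrix of Z^-1 from the frame B(z) to the frame B(qz). *)
Definition frame_conn : 'M[{poly C}]_N :=
  invmx (map_mx (dilate q) B) *m Zinv N kappa *m B.

Let uBq : map_mx (dilate q) B \in unitmx.
Proof. exact: unitmx_morph. Qed.

Lemma Zinv_frame : Zinv N kappa *m B = map_mx (dilate q) B *m frame_conn.
Proof. by rewrite /frame_conn -mulmxA mulKVmx. Qed.

(** The connection sends each iterate of s to the next one. *)
Lemma frame_conn_H (i j j' : 'I_N) : nat_of_ord j' = j.+1 ->
  (frame_conn *m H) i j = dilate q (H i j').
Proof.
move=> jj; have e : col j (frame_conn *m H) = map_mx (dilate q) (col j' H).
  rewrite /frame_conn -!mulmxA -cyclic_mxE colE -!mulmxA -colE (Zinv_cyclic_mx kappa_neq0 q0 s jj).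
  by rewrite cyclic_mxE [col j' _]colE -mulmxA -colE map_mxM mulKmx.
by have /matrixP/(_ i 0) := e; rewrite !mxE.
Qed.

(** The matrix frame_conn H is Hessenberg and H is triangular and invertible over
    C(z); solve column by column. *)
Lemma frame_conn_hessenberg (i j : 'I_N) : (j.+1 < i)%N -> frame_conn i j = 0.
Proof.
case: j => j jN /=; elim/ltn_ind: j jN => j IH jN ji.
have j'N : (j.+1 < N)%N by apply: ltn_trans ji _.
have := @frame_conn_H i (Ordinal jN) (Ordinal j'N) erefl.
rewrite tri // rmorph0 [X in X = _]mxE (bigD1 (Ordinal jN)) //= big1 ?addr0.
  by move/eqP; rewrite mulf_eq0 (negPf (diag_neq0 _)) orbF => /eqP.
move=> k kj; have [lt|ge] := ltnP k j.
  rewrite (_ : frame_conn i k = 0) ?mul0r //.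
  by case: k lt {kj} => k kN /= lt; apply: IH => //; lia.
by rewrite tri ?mulr0 //= ltn_neqAle ge andbT eq_sym; apply: contra kj => /eqP e; apply/eqP/val_inj.
Qed.

Lemma frame_conn_subdiag (j j' : 'I_N) : nat_of_ord j' = j.+1 ->
  frame_conn j' j * H j j = dilate q (H j' j').
Proof.
move=> jj; rewrite -(frame_conn_H _ jj) [RHS]mxE (bigD1 j) //= big1 ?addr0 // => k kj.
have [lt|ge] := ltnP k j; first by rewrite frame_conn_hessenberg ?mul0r //; lia.
by rewrite tri ?mulr0 //= ltn_neqAle ge andbT eq_sym.
Qed.
End Frame.

(** * Divisibility of the diagonal by the weights *)

Section FrameDivisors.
Variables (C : fieldType) (q : C) (N : nat) (kappa : nat -> C) (s : nat -> {poly C}).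
Hypothesis kappa_neq0 : forall i : nat, (0 < i <= N)%N -> kappa i != 0.

Let t := rev_index N s.

Definition row_cofactor (k j : nat) : {poly C} :=
  (-1) ^+ j * lminor k (fun i b => qentry q kappa t (qrow k k i) (bump j b)).

Lemma casorati_expand p k :
  casorati q kappa t p k.+1 = \sum_(j < k.+1) qentry q kappa t p j * row_cofactor k j.
Proof.
rewrite /casorati /lminor (expand_det_row _ ord0); apply: eq_bigr => j _.
rewrite mxE /cofactor /row_cofactor add0n; congr (_ * (_ * _)).
rewrite (det_row_col' (fun i j => qentry q kappa t (qrow p k.+1 i) j)).
by apply: eq_lminor => a b _ _; congr (qentry _ _ _); rewrite /qrow /bump; case: a => [|a] /=; lia.
Qed.

Lemma row_cofactor0 k : (k <= N)%N ->
  exists2 c : C, c != 0 & row_cofactor k 0 = c *: dilate q (casorati q kappa t k k).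
Proof.
move=> kN; exists (\prod_(i < k) kappa (qrow k k i)).
  apply/prodf_neq0 => i _; apply: kappa_neq0; have := ltn_ord i.
  by rewrite /qrow; case: (nat_of_ord i) => *; lia.
by rewrite /row_cofactor expr0 mul1r -mul_polyC -lminor_qentryS.
Qed.

Hypothesis q0 : q != 0.

(** Expanding F(p, k+1) along t_p expresses the vector of these determinants in
    the first k + 1 iterates of s, dilated by q^k, with coefficients independent
    of p. *)
Lemma casorati_cyclic_mx (k i : 'I_N) :
  casorati q kappa t (N - i) k.+1 =
  (zeta N kappa i.+1 ^+ k)%:P *
  \sum_(a < N) dilate (q ^+ k) (cyclic_mx q N kappa s i a) *
    (if (a <= k)%N then row_cofactor k (k - a) else 0).
Proof.
have iN := ltn_ord i; have kN := ltn_ord k.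
rewrite casorati_expand (reindex_inj rev_ord_inj) /=.
rewrite (big_ord_widen N (fun j => qentry q kappa t (N - i) (k.+1 - j.+1) *
  row_cofactor k (k.+1 - j.+1))) // big_mkcond mulr_sumr /=.
apply: eq_bigr => a _; rewrite ltnS; case: leqP => ak; last by rewrite !mulr0.
rewrite subSS mulrA; congr (_ * _); rewrite mxE /qentry.
have -> : t (N - i)%N = s i.+1 by rewrite /t /rev_index; congr s; lia.
have -> : kappa (N - i)%N = zeta N kappa i.+1 by rewrite /zeta; congr kappa; lia.
rewrite dilateZ dilateM mul_polyC scalerA; congr (_ *: dilate _ _).
  by rewrite -{2}(subnK ak) exprD mulfK // expf_neq0 // zeta_neq0.
by rewrite -{2}(subnK ak) exprD mulfK // expf_neq0.
Qed.

Variables (B H : 'M[{poly C}]_N).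
Hypothesis uB : B \in unitmx.
Hypothesis cyclic_mxE : cyclic_mx q N kappa s = B *m H.
Hypothesis tri : forall i j : 'I_N, (j < i)%N -> H i j = 0.

(** In the basis B(q^k z) the vector of the F(p, k+1) has coordinates divisible by
    w. As H is upper triangular, only the last iterate contributes to the k-th
    coordinate. *)
Lemma dvd_frame_diagonal (k : 'I_N) (w : {poly C}) :
  (forall p, (0 < p <= N)%N -> w %| casorati q kappa t p k.+1) ->
  w %| row_cofactor k 0 * dilate (q ^+ k) (H k k).
Proof.
move=> dw; have /fin_all_exists[G GE] (i : 'I_N) :
    exists g, casorati q kappa t (N - i) k.+1 = g * w.
  by apply/dvdpP; apply: dw; have := ltn_ord i; lia.
pose y := \col_(a < N) (if (a <= k)%N then row_cofactor k (k - a) else 0).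
pose Zk := diag_mx (\row_(i < N) (zeta N kappa i.+1 ^+ k)%:P).
pose Bk := map_mx (dilate (q ^+ k)) B.
have uZ : Zk \in unitmx.
  rewrite unitmxE det_diag unitr_prod // => i _; rewrite mxE poly_unitE size_polyC.
  have z0 : zeta N kappa i.+1 ^+ k != 0 by rewrite expf_neq0 // zeta_neq0.
  by rewrite z0 coefC eqxx unitfE z0.
have uM : Zk *m Bk \in unitmx by rewrite unitmx_mul uZ unitmx_morph.
have e : w *: \col_i G i = Zk *m Bk *m (map_mx (dilate (q ^+ k)) H *m y).
  rewrite -mulmxA [Bk *m _]mulmxA -map_mxM -cyclic_mxE mul_diag_mx.
  apply/matrixP=> i j; rewrite !mxE mulrC -GE casorati_cyclic_mx; congr (_ * _).
  by apply: eq_bigr => a _; rewrite !mxE.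
have {e} e : w * (invmx (Zk *m Bk) *m \col_i G i) k 0 =
    (map_mx (dilate (q ^+ k)) H *m y) k 0.
  by rewrite -[in RHS](mulKmx uM (_ *m y)) -e -scalemxAr [in RHS]mxE.
have y_k : (map_mx (dilate (q ^+ k)) H *m y) k 0 =
    row_cofactor k 0 * dilate (q ^+ k) (H k k).
  rewrite mxE (bigD1 k) //= big1 ?addr0 => [|a ak].
    by rewrite !mxE leqnn subnn mulrC.
  rewrite !mxE; case: leqP => [le|]; last by rewrite mulr0.
  by rewrite tri ?rmorph0 ?mul0r // ltn_neqAle le andbT.
by rewrite -y_k -e dvdp_mulr.
Qed.
End FrameDivisors.

Section WeightRatios.
Variables (C : fieldType) (q : C) (L : nat) (z : 'I_L -> C) (l : 'I_L -> nat -> nat).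
Hypothesis q0 : q != 0.

(** The quotient W_(k+1)(z) / W_k(qz). *)
Definition weight_ratio (k : nat) : {poly C} := \prod_(j < k) Lambda_shift q z l j.+1.

Lemma weight_ratio0 : weight_ratio 0 = 1.
Proof. by rewrite /weight_ratio big_ord0. Qed.

Lemma weight_ratioS k : weight_ratio k.+1 = weight_ratio k * Lambda_shift q z l k.+1.
Proof. by rewrite /weight_ratio big_ord_recr. Qed.

Lemma Wpoly_ratio k :
  Wpoly q z l k.+1 = weight_ratio k * dilate q (Wpoly q z l k).
Proof.
elim: k => [|k IH]; first by rewrite Wpoly1 Wpoly0 weight_ratio0 rmorph1 mulr1.
have nz : dilate q (Wpoly q z l k) != 0 by rewrite dilate_eq0 // Wpoly_neq0.
by apply: (mulIf nz); rewrite Wpoly_rec weight_ratioS IH; ring.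
Qed.

Lemma weight_ratio_neq0 k : weight_ratio k != 0.
Proof. by have := Wpoly_neq0 z l q0 k.+1; rewrite Wpoly_ratio mulf_eq0 negb_or => /andP[]. Qed.

Lemma deg_Wpoly k : (size (Wpoly q z l k)).-1 = (\sum_(j < k) (size (weight_ratio j)).-1)%N.
Proof.
elim: k => [|k IH]; first by rewrite Wpoly0 size_poly1 big_ord0.
rewrite Wpoly_ratio degM ?weight_ratio_neq0 ?dilate_eq0 ?Wpoly_neq0 // size_dilate // IH.
by rewrite big_ord_recr /= addnC.
Qed.
End WeightRatios.

(** * The generated q-oper has the prescribed singularities *)

Section SingularPoints.
Variables (C : fieldType) (q : C) (L : nat) (z : 'I_L -> C) (l : 'I_L -> nat -> nat).
Hypotheses (q0 : q != 0) (q_nroot : not_root_of_unity q).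
Hypothesis z_neq0 : forall m : 'I_L, z m != 0.
Hypothesis z_disj : forall m m' : 'I_L, m <> m' -> disjoint_lattices q (z m) (z m').

Definition singular_points (i : nat) : seq C :=
  [seq q ^- j * z m | m <- enum 'I_L, j <- index_iota (ell l m i.-1) (ell l m i)].

Lemma LambdaE i : Lambda q z l i = \prod_(x <- singular_points i) ('X - x%:P).
Proof. by rewrite /Lambda big_allpairs_dep big_enum. Qed.

Lemma mem_singular_points i x : singular_point q z l i x <-> x \in singular_points i.
Proof.
split=> [[m [j [ji ->]]]|/allpairsPdep[m [j [_ ji ->]]]].
  by apply/allpairsPdep; exists m, j; rewrite mem_enum mem_index_iota.
by exists m, j; rewrite mem_index_iota in ji.
Qed.

Lemma singular_points_uniq i : uniq (singular_points i).
Proof.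
apply: allpairs_uniq_dep => [|m _|]; rewrite ?enum_uniq ?iota_uniq //.
move=> [m j] [m' j'] /= _ _ e.
have mm : m = m'.
  apply/eqP; apply: contraT => /eqP mm'.
  by have := z_disj mm' (- j%:Z) (- j'%:Z); rewrite -!exprnN e eqxx.
subst m'; congr (existT _ _ _); apply/eqP; apply: contraT => jj.
have /mulIf := z_neq0 m => /(_ _ _ e); rewrite !exprnN => {}e.
have := expq_neq1 q_nroot (n := j%:Z - j'%:Z).
rewrite subr_eq0 eqz_nat jj => /(_ isT); rewrite expfzDr // -[q ^ - _]/(q ^ (- j'%:Z)).
by rewrite -e -expfzDr // subrr expr0z eqxx.
Qed.

Lemma mup_Lambda i (a : C) x : a != 0 -> singular_point q z l i x ->
  mup x (a *: Lambda q z l i) = 1%N.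
Proof.
move=> a0 /mem_singular_points xi; rewrite -mul_polyC mupMr ?rootC //.
by rewrite LambdaE mu_prod_XsubC count_uniq_mem ?singular_points_uniq // xi.
Qed.

Lemma root_Lambda i (a : C) x : a != 0 -> ~ singular_point q z l i x ->
  ~~ root (a *: Lambda q z l i) x.
Proof.
move=> a0 ns; rewrite rootZ // LambdaE root_prod_XsubC.
by apply/negP => /mem_singular_points.
Qed.
End SingularPoints.

Section CyclicOper.
Variables (C : fieldType) (q : C) (N L : nat) (z : 'I_L -> C) (l : 'I_L -> nat -> nat).
Variables (kappa : nat -> C).
Hypotheses (q0 : q != 0) (q_nroot : not_root_of_unity q).
Hypothesis z_neq0 : forall m : 'I_L, z m != 0.
Hypothesis z_disj : forall m m' : 'I_L, m <> m' -> disjoint_lattices q (z m) (z m').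
Hypothesis kappa_neq0 : forall i : nat, (0 < i <= N)%N -> kappa i != 0.
Hypothesis kappa_prod : \prod_(1 <= i < N.+1) kappa i = 1.

Lemma det_cyclic_mx_neq0 al s v :
  (forall k : nat, (0 < k <= N)%N -> al k != 0) ->
  qoper_equations q N z l kappa al s v -> \det (cyclic_mx q N kappa s) != 0.
Proof.
move=> al0 /qoper_equationsE e.
have [c c0 cE] := det_cyclic_mx kappa_neq0 q0 s.
rewrite -(dilate_eq0 _ (expf_neq0 N.-1 q0)) cE.
rewrite e // VpolyN mulr1 !scaler_eq0 !negb_or c0 (with_one_at0_neq0 al0) //.
by rewrite Wpoly_neq0.
Qed.

Variables (s : nat -> {poly C}) (v : nat -> seq C) (al : nat -> C).
Hypothesis al0 : forall k : nat, (0 < k <= N)%N -> al k != 0.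
Hypothesis nd : roots_nondegenerate q N z v.
Hypothesis eqs : qoper_equations q N z l kappa al s v.
Hypothesis W_dvd : forall m p, (0 < m <= p)%N -> (p <= N)%N ->
  Wpoly q z l m %| casorati q kappa (rev_index N s) p m.

Let det0 := det_cyclic_mx_neq0 al0 eqs.

Section WithFrame.
Variables (B H : 'M[{poly C}]_N).
Hypothesis uB : B \in unitmx.
Hypothesis cyclic_mxE : cyclic_mx q N kappa s = B *m H.
Hypothesis tri : forall i j : 'I_N, (j < i)%N -> H i j = 0.

(** In dvd_frame_diagonal the cofactor is a multiple of D_k(qz), that is, of
    W_k(qz) V_k(qz). Its first factor is common to W_(k+1), and the second one is
    prime to it by nondegeneracy. *)
Lemma weight_ratio_dvd_diag (k : 'I_N) :
  weight_ratio q z l k %| dilate (q ^+ k) (H k k).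
Proof.
have kN := ltn_ord k.
have dw p : (0 < p <= N)%N -> Wpoly q z l k.+1 %| casorati q kappa (rev_index N s) p k.+1.
  move=> pN; have [kp|pk] := ltnP k p; first by apply: W_dvd; lia.
  by rewrite casorati_repeated ?dvdp0 //; lia.
have := dvd_frame_diagonal kappa_neq0 q0 uB cyclic_mxE tri dw.
have [c c0 ->] := row_cofactor0 q s kappa_neq0 (ltnW kN).
rewrite ((qoper_equationsE _ _ _ _ _ _ _ _).1 eqs) ?(ltnW kN) //.
rewrite dilateZ scalerA rmorphM /= -scalerAl dvdpZr; last first.
  by rewrite mulf_neq0 // (with_one_at0_neq0 al0) // ltnW.
rewrite Wpoly_ratio // mulrC -mulrA dvdp_mul2l ?dilate_eq0 ?Wpoly_neq0 //.
rewrite Gauss_dvdpr //.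
have [c' c'0 ->] := dilate_prod_XsubC q0 (level N v k).
rewrite coprimepZr //; apply: coprimep_prod_XsubC => _ /mapP[x xk ->].
have xz m := level_disjoint_z nd m xk.
have := Wpoly_lattice_neq0 l q0 k.+1 xz (-1).
by rewrite exprN1 Wpoly_ratio // hornerM mulf_eq0 negb_or => /andP[].
Qed.

(** The diagonal entries of H and the weight ratios have products of the same
    degree, that of W_N: B is unimodular, and the full Casorati determinant is a
    multiple of W_N. So none of the divisibilities of weight_ratio_dvd_diag can be
    strict. *)
Lemma diag_weight_ratio (k : 'I_N) :
  exists2 a : C, a != 0 & dilate (q ^+ k) (H k k) = a *: weight_ratio q z l k.
Proof.
have d0 i := diag_neq0 cyclic_mxE tri det0 i.
have /fin_all_exists[e eE] (i : 'I_N) :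
    exists e, dilate (q ^+ i) (H i i) = e * weight_ratio q z l i.
  by apply/dvdpP; exact: weight_ratio_dvd_diag.
have e0 i : e i != 0.
  have : dilate (q ^+ i) (H i i) != 0 by rewrite dilate_eq0 // expf_neq0.
  by rewrite eE mulf_eq0 negb_or => /andP[].
have degH : (size (\det H)).-1 = (size (Wpoly q z l N)).-1.
  have [c c0 cE] := det_cyclic_mx kappa_neq0 q0 s.
  have [b b0 bE] := unitmx_poly_det uB.
  have := congr1 (fun p : {poly C} => size p) cE.
  rewrite /= size_dilate ?expf_neq0 // size_scale // cyclic_mxE det_mulmx bE.
  rewrite mul_polyC size_scale //.
  rewrite ((qoper_equationsE _ _ _ _ _ _ _ _).1 eqs) // VpolyN mulr1 => ->.
  by rewrite size_scale // (with_one_at0_neq0 al0).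
have degs i : (size (H i i)).-1 = ((size (e i)).-1 + (size (weight_ratio q z l i)).-1)%N.
  by rewrite -degM ?weight_ratio_neq0 // -eE size_dilate // expf_neq0.
have sum0 : (\sum_(i < N) (size (e i)).-1 = 0)%N.
  have := degH; rewrite det_triangular // deg_prod // deg_Wpoly //.
  under eq_bigr do rewrite degs; rewrite big_split /=.
  by move=> E; apply/eqP; rewrite -(eqn_add2r (\sum_(i < N) (size (weight_ratio q z l i)).-1)) E.
have ek : (size (e k)).-1 = 0%N.
  by move/eqP: sum0; rewrite sum_nat_eq0 => /forallP/(_ k)/eqP.
have [a a0 aE] := deg_const (e0 k) ek.
by exists a => //; rewrite eE aE mul_polyC.
Qed.

Lemma frame_conn_Lambda (j j' : 'I_N) : nat_of_ord j' = j.+1 ->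
  exists2 a : C, a != 0 & frame_conn q kappa B j' j = a *: Lambda q z l j'.
Proof.
move=> jj; have [a a0 aE] := diag_weight_ratio j.
have [a' a'0 a'E] := diag_weight_ratio j'.
exists (a' / a); first by rewrite mulf_neq0 ?invr_eq0.
have := congr1 (dilate (q ^+ j)) (frame_conn_subdiag q0 kappa_neq0 uB cyclic_mxE tri det0 jj).
rewrite rmorphM /= aE dilateM -exprSr -jj a'E jj weight_ratioS -!scalerAr => e.
apply: (dilate_inj (expf_neq0 j q0)); rewrite dilateZ.
apply: (mulIf (weight_ratio_neq0 z l q0 j)); rewrite -scalerAl.
apply: (scalerI a0); rewrite e scalerA mulrCA mulfV // mulr1 mulrC.
by rewrite /Lambda_shift.
Qed.
End WithFrame.

Lemma gauge1 (A : 'M[ratfun C]_N) : gauge q 1%:M A = A.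
Proof.
have e : polmx 1%:M = 1%:M :> 'M[ratfun C]_N by exact: map_mx1.
by rewrite /gauge map_qpull_polmx // map_mx1 e invmx1 mulmx1 mul1mx.
Qed.

Lemma cyclic_oper_SL_qconnection : SL_qconnection q (cstmx (invmx (Zmx N kappa))).
Proof.
have detZ := det_Zmx kappa_prod.
have det1 : \det (cstmx (invmx (Zmx N kappa))) = 1.
  rewrite /cstmx /polmx !det_map_mx /= det_inv detZ invr1.
  by rewrite !rmorph1.
split; first by rewrite unitmxE det1 unitr1.
by exists (cstmx (invmx (Zmx N kappa))) => //; exists 1%:M; rewrite ?unitmx1 ?gauge1.
Qed.

Lemma cyclic_oper_complete_flag : complete_flag (qflag (cyclic_oper q N kappa s)).
Proof.
split=> i iN /=; first by rewrite dim_colspan // polmx_unit.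
by rewrite (colspanS _ (Ordinal iN)) addvSl.
Qed.

(** The columns of B are the required frame: the columns of B and the iterates of
    s span the same flag. *)
Lemma cyclic_oper_regular : regular_singularities q z l (cyclic_oper q N kappa s).
Proof.
have [B [H [uB cyclic_mxE tri]]] := hermite_form (cyclic_mx q N kappa s).
pose f i : 'cV[{poly C}]_N := oapp (fun j : 'I_N => col j B) 0 (insub i.-1).
have fE (j : 'I_N) : f j.+1 = col j B by rewrite /f /= valK.
have spanE := colspan_frame uB cyclic_mxE tri det0.
exists f.
  split=> [|i iN].
    rewrite (_ : \matrix_(i, j) _ = B) //.
    by apply/matrixP=> i j; rewrite mxE fE mxE.
  have i'N : (i.-1 < N)%N by lia.
  rewrite /= spanE ?(andP iN).2 // (_ : i = (Ordinal i'N).+1); last by rewrite /= prednK //; lia.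
  by rewrite fE polmx_col col_colspan.
case=> // j jN; pose j0 := Ordinal (ltnW jN); pose j1 := @Ordinal N j.+1 jN.
have jj : nat_of_ord j1 = j0.+1 by [].
have [a a0 cE] := frame_conn_Lambda uB cyclic_mxE tri jj.
exists (frame_conn q kappa B j1 j0); split.
- have qV0 : q^-1 != 0 by rewrite invr_eq0.
  pose c := frame_conn q kappa B j1 j0.
  pose w := col j0 (frame_conn q kappa B) - c *: delta_mx j1 0.
  have w0 (i : 'I_N) : (j.+1 <= i)%N -> w i 0 = 0.
    have wE : w i 0 = frame_conn q kappa B i j0 - c * (i == j1)%:R.
      by rewrite /w /c; move: (frame_conn q kappa B) => Y; rewrite !mxE eqxx andbT.
    rewrite wE leq_eqVlt => /predU1P[ij|ji].
      have -> : i = j1 by apply: val_inj.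
      by rewrite eqxx mulr1 subrr.
    rewrite (frame_conn_hessenberg q0 kappa_neq0 uB cyclic_mxE tri det0) //.
    by rewrite (_ : i == j1 = false) ?mulr0 ?subrr //; apply/eqP => ij; rewrite ij /= ltnn in ji.
  exists (polmx B *m map_mx (qpull q^-1) (polmx w)).
    rewrite /= spanE ?(ltnW jN) //; apply/mem_colspan.
    exists (map_mx (qpull q^-1) (polmx w)) => // i ji.
    by rewrite mxE mxE w0 // -[qpull _ _]/(qpull_rmorphism qV0 _) !rmorph0.
  rewrite map_qpullM // map_qpullK // map_qpull_polmx // -polmxM.
  rewrite (fE j0) (fE j1) map_qpull_polmx //.
  rewrite -/(Zinv N kappa).
  have e1 : Zinv N kappa *m col j0 B = map_mx (dilate q) B *m col j0 (frame_conn q kappa B).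
    by rewrite colE mulmxA (@Zinv_frame _ q _ kappa _ uB) -mulmxA -colE.
  have e2 : map_mx (dilate q) (col j1 B) = map_mx (dilate q) B *m delta_mx j1 0.
    by rewrite -colE; apply/matrixP=> a' b'; rewrite !mxE.
  have e3 : polmx w = polmx (col j0 (frame_conn q kappa B)) -
      FracField.tofrac c *: polmx (delta_mx j1 0).
    rewrite /w /c; move: (frame_conn q kappa B) => Y.
    by apply/matrixP=> a' b'; rewrite !mxE !(rmorphB, rmorphM).
  by rewrite e1 e2 !polmxM e3 mulmxBr -scalemxAr.
- by move=> x xs; rewrite cE; apply: mup_Lambda.
- by move=> x xs; rewrite cE; apply: root_Lambda.
Qed.

Lemma cyclic_oper_SL_qoper : SL_qoper q z l (cyclic_oper q N kappa s).
Proof.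
split.
- exact: cyclic_oper_SL_qconnection.
- exact: cyclic_oper_complete_flag.
- by move=> i /andP[_ iN] w; apply: cyclic_oper_flag_map.
- exact: cyclic_oper_regular.
Qed.

Lemma cyclic_oper_Z_twisted : Z_twisted q kappa (cyclic_oper q N kappa s).
Proof. by exists 1%:M; rewrite ?unitmx1 ?gauge1. Qed.

Hypothesis N_gt0 : (0 < N)%N.

(** The first diagonal entry of H is a constant, so s is a multiple of the first
    column of the unimodular matrix B. *)
Lemma cyclic_oper_generating_section : generating_section (qflag (cyclic_oper q N kappa s) 1) s.
Proof.
have col0 := col0_cyclic_mx q kappa N_gt0 s.
split; first by rewrite /= dim_colspan // polmx_unit.
split; first by rewrite -col0 polmx_col col_colspan.
move=> x.
have [/existsP[i ix]|] := boolP [exists i : 'I_N, (s i.+1).[x] != 0].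
  by exists i.+1 => //=; exact: ltn_ord.
rewrite negb_exists => /forallP sx.
have [B [H [uB cyclic_mxE tri]]] := hermite_form (cyclic_mx q N kappa s).
have [a a0 aE] := diag_weight_ratio uB cyclic_mxE tri (Ordinal N_gt0).
rewrite dilate1 weight_ratio0 in aE.
have [b b0 bE] := unitmx_poly_det uB.
suff : (\det B).[x] == 0 by rewrite bE hornerC (negPf b0).
rewrite (expand_det_col _ (Ordinal N_gt0)) horner_sum big1 // => i _.
have e : s i.+1 = B i (Ordinal N_gt0) * a%:P.
  have /matrixP/(_ i 0) := col0; rewrite [RHS]mxE [LHS]mxE cyclic_mxE => <-.
  rewrite mxE (bigD1 (Ordinal N_gt0)) //= big1 ?addr0 => [|k k0].
    by rewrite aE alg_polyC.
  by rewrite tri ?mulr0 // lt0n; apply: contra k0 => /eqP e; apply/eqP/val_inj.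
have /negPn/eqP := sx i; rewrite e hornerM hornerC => /eqP.
by rewrite mulf_eq0 (negPf a0) orbF hornerM => /eqP ->; rewrite mul0r.
Qed.
End CyclicOper.

(** * Isomorphisms of q-opers with constant diagonal connection *)

Section Isomorphisms.
Variables (C : fieldType) (q : C) (N : nat).
Hypothesis q0 : q != 0.
Implicit Types (g h : 'M[{poly C}]_N) (O : qflagged C N).

Lemma polmx_unitmx g : g \in unitmx -> polmx g \in unitmx.
Proof. by move=> ug; rewrite polmx_unit unitmx_det_neq0. Qed.

Lemma polmx1 : polmx 1%:M = 1%:M :> 'M[ratfun C]_N.
Proof. exact: map_mx1. Qed.

Lemma gaugeP g A A' : g \in unitmx ->
  gauge q g A = A' <-> polmx (map_mx (dilate q) g) *m A = A' *m polmx g.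
Proof.
move=> ug; have ug' := polmx_unitmx ug; rewrite /gauge map_qpull_polmx //.
by split=> [<-|->]; rewrite ?mulmxKV ?mulmxK.
Qed.

Lemma qoper_iso_refl O : qoper_iso q O O.
Proof.
exists 1%:M; first exact: unitmx1.
split; last by move=> i _ w; rewrite polmx1 mul1mx.
by apply/gaugeP; rewrite ?unitmx1 // map_mx1 polmx1 mulmx1 mul1mx.
Qed.

Lemma qoper_iso_sym O O' : qoper_iso q O O' -> qoper_iso q O' O.
Proof.
case=> g ug [/(gaugeP _ _ ug) gA gU]; have ug' := polmx_unitmx ug.
have uV : invmx g \in unitmx by rewrite unitmx_inv.
have VK : polmx (invmx g) *m polmx g = 1%:M by rewrite -polmxM mulVmx // polmx1.
have KV : polmx g *m polmx (invmx g) = 1%:M by rewrite -polmxM mulmxV // polmx1.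
exists (invmx g) => //; split=> [|i iN w].
  apply/gaugeP => //; rewrite -[LHS]mulmx1 -KV [LHS]mulmxA -[_ *m _ *m polmx g]mulmxA -gA.
  by rewrite !mulmxA -polmxM -map_mxM mulVmx // map_mx1 polmx1 mul1mx.
by rewrite -gU // mulmxA KV mul1mx.
Qed.

Lemma qoper_iso_trans O1 O2 O3 :
  qoper_iso q O1 O2 -> qoper_iso q O2 O3 -> qoper_iso q O1 O3.
Proof.
case=> g ug [/(gaugeP _ _ ug) gA gU] [h uh [/(gaugeP _ _ uh) hA hU]].
exists (h *m g); first by rewrite unitmx_mul uh.
split=> [|i iN w]; last by rewrite polmxM -mulmxA hU // gU.
apply/gaugeP; first by rewrite unitmx_mul uh.
by rewrite map_mxM !polmxM -mulmxA gA mulmxA hA mulmxA.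
Qed.

Lemma map_qpull_inj m n : injective (fun A : 'M[ratfun C]_(m, n) => map_mx (qpull q) A).
Proof.
have qV0 : q^-1 != 0 by rewrite invr_eq0.
move=> A A' e; have := map_qpullK A qV0; have := map_qpullK A' qV0.
by rewrite invrK e => -> ->.
Qed.
End Isomorphisms.

Section TwistedIsomorphisms.
Variables (C : fieldType) (q : C) (N : nat) (kappa : nat -> C).
Hypotheses (q0 : q != 0) (q_nroot : not_root_of_unity q).
Hypothesis kappa_neq0 : forall i : nat, (0 < i <= N)%N -> kappa i != 0.
Hypothesis kappa_disj : forall i j : nat, (0 < i <= N)%N -> (0 < j <= N)%N ->
  i <> j -> disjoint_lattices q (kappa i) (kappa j).

(** In g(qz) Z^-1 = Z^-1 g(z) the coefficients of z^n in the entry (i, j) give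
    q^n zeta_i = zeta_j unless they vanish, and this forces i = j and n = 0. *)
Lemma gauge_Zinv (g : 'M[{poly C}]_N) : g \in unitmx ->
  gauge q g (cstmx (invmx (Zmx N kappa))) = cstmx (invmx (Zmx N kappa)) ->
  exists c : 'I_N -> C, (forall i, c i != 0) /\ g = diag_mx (\row_i (c i)%:P).
Proof.
move=> ug /(gaugeP q0 _ _ ug); rewrite -[cstmx _]/(polmx (Zinv N kappa)) -!polmxM => /polmx_inj e.
have co (i j : 'I_N) n : q ^+ n * (g i j)`_n * zeta N kappa i.+1 = zeta N kappa j.+1 * (g i j)`_n.
  have /matrixP/(_ i j) := e; rewrite (mul_Zinv kappa_neq0) mxE (bigD1 j) //= big1 => [|k kj].
    rewrite addr0 (ZinvE kappa_neq0) eqxx mulr1n mxE => {}e.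
    have := congr1 (fun p : {poly C} => p`_n) e; rewrite /= coefMC coef_dilate coefZ => {}e.
    have zi := zeta_neq0 kappa_neq0 i; have zj := zeta_neq0 kappa_neq0 j.
    apply: (mulfI (invr_neq0 zi)); apply: (mulfI (invr_neq0 zj)).
    rewrite -mulrCA [X in _ = X]mulrCA mulKf // -e.
    by field; rewrite zi zj.
  by rewrite (ZinvE kappa_neq0) (negPf kj) mulr0.
have off (i j : 'I_N) : i != j -> g i j = 0.
  move=> ij; apply/polyP=> n; rewrite coef0; apply/eqP; apply: contraT => gn.
  have := co i j n; rewrite -mulrA [(g i j)`_n * _]mulrC mulrA => /(mulIf gn) {}e.
  have iN := ltn_ord i; have jN := ltn_ord j.
  have := kappa_disj (i := (N.+1 - i.+1)%N) (j := (N.+1 - j.+1)%N) ltac:(lia) ltac:(lia).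
  have ne : (N.+1 - i.+1)%N <> (N.+1 - j.+1)%N.
    by move=> h; move/eqP: ij; apply; apply: val_inj => /=; lia.
  by move=> /(_ ne n 0); rewrite expr0z mul1r -exprnP -/(zeta N kappa i.+1) e eqxx.
have diag (i : 'I_N) n : (0 < n)%N -> (g i i)`_n = 0.
  move=> n0; apply/eqP; apply: contraT => gn.
  have nz : zeta N kappa i.+1 * (g i i)`_n != 0 by rewrite mulf_neq0 // zeta_neq0.
  have := q_nroot n0; rewrite -(inj_eq (mulIf nz)) mul1r.
  by have := co i i n; rewrite -mulrA [(g i i)`_n * _]mulrC => ->; rewrite eqxx.
have gE : g = diag_mx (\row_i ((g i i)`_0)%:P).
  apply/matrixP=> i j; rewrite !mxE; case: eqP => [<-|/eqP ij]; last by rewrite mulr0n off.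
  rewrite mulr1n; apply/polyP=> n; rewrite coefC; case: n => [|n] //=.
  by rewrite diag.
exists (fun i => (g i i)`_0); split=> // i.
have : \det (diag_mx (\row_i ((g i i)`_0)%:P)) != 0 by rewrite -gE unitmx_det_neq0.
by rewrite det_diag => /prodf_neq0/(_ i isT); rewrite mxE polyC_eq0.
Qed.
End TwistedIsomorphisms.

(** * The flag and the line of sections of a Z-twisted q-oper *)

Section FlagFromSection.
Variables (C : fieldType) (q : C) (N L : nat) (z : 'I_L -> C) (l : 'I_L -> nat -> nat).
Variable kappa : nat -> C.
Hypotheses (q0 : q != 0) (N_gt0 : (0 < N)%N).
Hypothesis kappa_neq0 : forall i : nat, (0 < i <= N)%N -> kappa i != 0.

(** The iterates of s lie in the members of the flag, since the connection maps
    L_i to L_(i+1)^q, and they are independent; compare dimensions. *)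
Lemma flag_from_section (O O' : qflagged C N) (s : nat -> {poly C}) :
  SL_qoper q z l O -> qoper_iso q O O' ->
  qconn O' = cstmx (invmx (Zmx N kappa)) ->
  polmx (\col_(i < N) s i.+1) \in qflag O' 1 ->
  \det (cyclic_mx q N kappa s) != 0 ->
  forall k w, (k <= N)%N -> (w \in qflag O' k) = (w \in colspan (polmx (cyclic_mx q N kappa s)) k).
Proof.
move=> [_ [dimU nest] conn _] [g ug [/(gaugeP q0 _ _ ug) gA gU]] Z' s1 det0 k w kN.
rewrite Z' in gA; have ug' := polmx_unitmx ug.
have uh : polmx (cyclic_mx q N kappa s) \in unitmx by rewrite polmx_unit.
pose M := invmx (polmx g) *m polmx (cyclic_mx q N kappa s).
have uM : M \in unitmx by rewrite unitmx_mul unitmx_inv ug'.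
have gM : polmx g *m M = polmx (cyclic_mx q N kappa s) := mulKVmx ug' _.
have gcol (i : 'I_N) : polmx g *m col i M = col i (polmx (cyclic_mx q N kappa s)).
  by rewrite colE mulmxA gM -colE.
have sub i j : (i <= j)%N -> (j <= N)%N -> (qflag O i <= qflag O j)%VS.
  elim: j => [|j IH]; first by rewrite leqn0 => /eqP ->.
  rewrite leq_eqVlt => /predU1P[-> //|ij] jN.
  by apply: subv_trans (IH ij (ltnW jN)) _; apply: nest.
have colM (j : 'I_N) : col j M \in qflag O j.+1.
  case: j => j jN; elim: j jN => [|j IH] jN.
    have -> : Ordinal jN = Ordinal N_gt0 by apply: val_inj.
    by rewrite -gU // gcol -polmx_col col0_cyclic_mx.
  have [x xU xE] := conn j.+1 ltac:(lia) _ (IH (ltnW jN)).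
  suff -> : col (Ordinal jN) M = x by [].
  apply: (can_inj (mulKmx ug')); apply: (map_qpull_inj q0); rewrite gcol.
  rewrite (map_qpullM q0) -xE (map_qpull_polmx q0) [RHS]mulmxA gA -[RHS]mulmxA gcol.
  rewrite -[cstmx _]/(polmx (Zinv N kappa)) -!polmx_col -polmxM.
  rewrite (@Zinv_cyclic_mx _ q _ _ kappa_neq0 q0 s (Ordinal (ltnW jN)) (Ordinal jN)) //.
  by rewrite map_qpull_polmx.
have spanE : colspan M k = qflag O k.
  apply: (colspan_eq uM kN (dimU k kN)) => j jk.
  by apply: (subvP (sub j.+1 k jk kN)); exact: colM.
have wE : w = polmx g *m (invmx (polmx g) *m w) by rewrite (mulKVmx ug').
rewrite [in LHS]wE gU // -spanE -gM [in RHS]wE.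
exact: (esym (colspan_mul M k (invmx (polmx g) *m w) ug')).
Qed.
End FlagFromSection.

Section GeneratingSections.
Variables (C : closedFieldType) (N : nat).
Hypothesis N_gt0 : (0 < N)%N.

(** The ratio of the two sections is a reduced fraction, and a zero of its
    numerator or denominator would be a common zero of the components of one of
    them. *)
Lemma proportional_sections (U : {vspace 'cV[ratfun C]_N}) (s s' : nat -> {poly C}) :
  generating_section U s -> generating_section U s' ->
  exists2 a : C, a != 0 & forall i, (0 < i <= N)%N -> s' i = a *: s i.
Proof.
have nz (r : nat -> {poly C}) : (forall x : C, exists2 i : nat, (0 < i <= N)%N & (r i).[x] != 0) ->
    polmx (\col_(i < N) r i.+1) != 0.
  move=> /(_ 0)[i iN ri]; apply/eqP => /matrixP/(_ (@Ordinal N i.-1 ltac:(lia)) 0).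
  rewrite !mxE prednK; last by lia.
  by move/eqP; rewrite tofrac_eq0 => /eqP e; rewrite e horner0 eqxx in ri.
have no_root (r r' : nat -> {poly C}) (n d : {poly C}) :
    (forall x : C, exists2 i : nat, (0 < i <= N)%N & (r i).[x] != 0) ->
    coprimep n d -> (forall i, (0 < i <= N)%N -> d * r' i = n * r i) ->
    exists a : C, d = a%:P.
  move=> rN co e; have sd : (size d == 1)%N.
    apply: contraT => /closed_rootP[x dx]; have [i iN rix] := rN x.
    have nx : n.[x] != 0 by apply: coprimep_root dx; rewrite coprimep_sym.
    have := congr1 (fun p => p.[x]) (e i iN); rewrite /= !hornerM.
    move/rootP: dx => ->; rewrite mul0r => /esym/eqP.
    by rewrite mulf_eq0 (negPf nx) (negPf rix).
  by exists d`_0; apply: size1_polyC; rewrite (eqP sd).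
move=> [dU [sU sN]] [_ [s'U s'N]].
have UE : U = <[polmx (\col_(i < N) s i.+1)]>%VS.
  by apply/esym/eqP; rewrite eqEdim -memvE sU dU dim_vline nz.
have [x xE] : exists x, polmx (\col_(i < N) s' i.+1) = x *: polmx (\col_(i < N) s i.+1).
  by apply/vlineP; rewrite -UE.
have [n [d [d0 xnd]]] := frac_quotient x.
have n0 : n != 0.
  by apply: contraNneq (nz s' s'N) => e; rewrite xE xnd e rmorph0 mul0r scale0r.
have nd i : (0 < i <= N)%N -> d * s' i = n * s i.
  move=> iN; have /matrixP/(_ (@Ordinal N i.-1 ltac:(lia)) 0) := xE.
  rewrite xnd !mxE prednK; last by lia.
  move=> e; apply/eqP; rewrite -tofrac_eq !tofracM e mulrA [_ * (_ / _)]mulrC divfK ?tofrac_eq0 //.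
pose p := gcdp n d.
have p0 : p != 0 by rewrite gcdp_eq0 negb_and n0.
have nE : n = n %/ p * p by rewrite divpK ?dvdp_gcdl.
have dE : d = d %/ p * p by rewrite divpK ?dvdp_gcdr.
have co : coprimep (n %/ p) (d %/ p) by rewrite coprimep_div_gcd ?n0.
have nd' i : (0 < i <= N)%N -> d %/ p * s' i = n %/ p * s i.
  move=> iN; apply: (mulfI p0); rewrite !mulrA ![p * _]mulrC -nE -dE; exact: nd.
have [b bE] := no_root s s' _ _ sN co nd'.
have [|a aE] := no_root s' s (d %/ p) (n %/ p) s'N _ (fun i iN => esym (nd' i iN)).
  by rewrite coprimep_sym.
have b0 : b != 0 by apply: contraNneq d0 => e; rewrite dE bE e mul0r.
have a0 : a != 0 by apply: contraNneq n0 => e; rewrite nE aE e mul0r.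
exists (a / b); first by rewrite mulf_neq0 ?invr_eq0.
move=> i iN; have := nd' i iN; rewrite aE bE !mul_polyC => e.
by rewrite mulrC -scalerA -e scalerA mulVf // scale1r.
Qed.
End GeneratingSections.

(** * The correspondence *)

Section Correspondence.
Variables (C : closedFieldType) (N L : nat) (q qh : C).
Variables (z : 'I_L -> C) (l : 'I_L -> nat -> nat) (kappa : nat -> C).
Hypotheses (N_gt0 : (0 < N)%N) (q0 : q != 0) (q_nroot : not_root_of_unity q).
Hypothesis qhE : qh ^+ 2 = q.
Hypothesis z_neq0 : forall m : 'I_L, z m != 0.
Hypothesis z_disj : forall m m' : 'I_L, m <> m' -> disjoint_lattices q (z m) (z m').
Hypothesis kappa_neq0 : forall i : nat, (0 < i <= N)%N -> kappa i != 0.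
Hypothesis kappa_prod : \prod_(1 <= i < N.+1) kappa i = 1.
Hypothesis kappa_disj : forall i j : nat, (0 < i <= N)%N -> (0 < j <= N)%N ->
  i <> j -> disjoint_lattices q (kappa i) (kappa j).

Let Zi := cstmx (invmx (Zmx N kappa)).

(** Constant diagonal matrices commute with Z. *)
Lemma scaled_sections_iso (O1 O2 : qflagged C N) (s1 s2 : nat -> {poly C}) (c : nat -> C) :
  qconn O1 = Zi -> qconn O2 = Zi ->
  (forall k w, (k <= N)%N ->
     (w \in qflag O1 k) = (w \in colspan (polmx (cyclic_mx q N kappa s1)) k)) ->
  (forall k w, (k <= N)%N ->
     (w \in qflag O2 k) = (w \in colspan (polmx (cyclic_mx q N kappa s2)) k)) ->
  (forall i, (0 < i <= N)%N -> c i != 0 /\ s2 i = c i *: s1 i) ->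
  qoper_iso q O1 O2.
Proof.
move=> Z1 Z2 U1 U2 cE; pose g : 'M[{poly C}]_N := diag_mx (\row_i (c i.+1)%:P).
have c0 (i : 'I_N) : c i.+1 != 0 by apply: (cE _ _).1; exact: ltn_ord.
have ug : g \in unitmx.
  rewrite unitmxE det_diag unitr_prod // => i _; rewrite mxE poly_unitE size_polyC.
  by rewrite c0 coefC eqxx unitfE c0.
have cyclic_mxE : cyclic_mx q N kappa s2 = g *m cyclic_mx q N kappa s1.
  rewrite mul_diag_mx; apply/matrixP=> i j; rewrite !mxE (cE _ _).2 ?ltn_ord //.
  by rewrite dilateZ mul_polyC !scalerA mulrC.
exists g => //; split=> [|i iN w].
  apply/gaugeP => //; rewrite Z1 Z2 /Zi -[cstmx _]/(polmx (Zinv N kappa)) -!polmxM.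
  congr polmx; apply/matrixP=> i j; rewrite (mul_Zinv kappa_neq0).
  rewrite mxE (bigD1 j) //= big1 => [|k kj]; last by rewrite (ZinvE kappa_neq0) (negPf kj) mulr0.
  rewrite addr0 (ZinvE kappa_neq0) eqxx mulr1n !mxE; case: eqP => [->|_].
    by rewrite !mulr1n dilateC mulrC mul_polyC.
  by rewrite !mulr0n rmorph0 mul0r scaler0.
rewrite U1 // U2 // cyclic_mxE polmxM.
exact: (colspan_mul _ _ _ (polmx_unitmx ug)).
Qed.

Lemma attached_roots_iso (O1 O2 : qflagged C N) (v : nat -> seq C) :
  SL_qoper q z l O1 -> SL_qoper q z l O2 ->
  attached_roots q z l kappa O1 v -> attached_roots q z l kappa O2 v ->
  qoper_iso q O1 O2.
Proof.
move=> S1 S2 [O1' [s1 [al1 [iso1 Z1 [_ [s1U _]] al1_0 e1]]]].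
move=> [O2' [s2 [al2 [iso2 Z2 [_ [s2U _]] al2_0 e2]]]].
have det1 := det_cyclic_mx_neq0 q0 kappa_neq0 al1_0 e1.
have det2 := det_cyclic_mx_neq0 q0 kappa_neq0 al2_0 e2.
have U1 := flag_from_section q0 N_gt0 kappa_neq0 S1 iso1 Z1 s1U det1.
have U2 := flag_from_section q0 N_gt0 kappa_neq0 S2 iso2 Z2 s2U det2.
have [c cE] := qoper_sections_unique q0 kappa_neq0 kappa_disj al1_0 al2_0 e1 e2.
apply: (qoper_iso_trans q0 iso1); apply: (qoper_iso_trans q0 _ (qoper_iso_sym q0 iso2)).
exact: scaled_sections_iso Z1 Z2 U1 U2 cE.
Qed.

(** Transported by the isomorphism, the two sections generate the same line, so
    their components differ by constant factors, and the determinants D_k by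
    constant factors too. *)
Lemma iso_attached_roots (O1 O2 : qflagged C N) (v1 v2 : nat -> seq C) :
  qoper_iso q O1 O2 ->
  attached_roots q z l kappa O1 v1 -> attached_roots q z l kappa O2 v2 ->
  forall k, (0 < k < N)%N -> perm_eq (v1 k) (v2 k).
Proof.
move=> iso [O1' [s1 [al1 [iso1 Z1 gen1 al1_0 /qoper_equationsE e1]]]].
move=> [O2' [s2 [al2 [iso2 Z2 gen2 al2_0 /qoper_equationsE e2]]]] k kN.
have [g ug [gA gU]] : qoper_iso q O1' O2'.
  by apply: (qoper_iso_trans q0 (qoper_iso_sym q0 iso1)); apply: (qoper_iso_trans q0 iso iso2).
rewrite Z1 Z2 in gA.
have [c [c0 gE]] := gauge_Zinv q0 q_nroot kappa_neq0 kappa_disj ug gA.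
pose c' i := if insub i.-1 is Some j then c j else 0.
have c'E (j : 'I_N) : c' j.+1 = c j by rewrite /c' /= valK.
have gen : generating_section (qflag O2' 1) (fun i => c' i *: s1 i).
  have [d1 [s1U s1N]] := gen1; have [d2 _] := gen2; split=> //; split=> [|x].
    suff -> : polmx (\col_(i < N) (c' i.+1 *: s1 i.+1)) =
        polmx g *m polmx (\col_(i < N) s1 i.+1) by rewrite gU.
    rewrite -polmxM gE mul_diag_mx; congr polmx; apply/matrixP=> i j.
    by rewrite !mxE c'E mul_polyC.
  have [i iN s1i] := s1N x; exists i => //; rewrite hornerZ mulf_neq0 //.
  have i'N : (i.-1 < N)%N by lia.
  by rewrite (_ : i = (Ordinal i'N).+1) ?c'E //= prednK //; lia.
have [a a0 aE] := proportional_sections N_gt0 gen gen2.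
have scal : casorati q kappa (rev_index N s2) k k =
    (\prod_(i < k) (a * c' (N.+1 - qrow k k i)%N)) *: casorati q kappa (rev_index N s1) k k.
  rewrite -(casorati_scale _ _ (fun p => a * c' (N.+1 - p)%N)).
  have si p : (0 < p <= N)%N -> rev_index N s2 p = (a * c' (N.+1 - p)%N) *: rev_index N s1 p.
    by move=> pN; rewrite /rev_index aE ?scalerA //; lia.
  by apply: eq_casorati => [||i ik]; [lia | apply: si; lia | apply: si; lia].
have kN' : (k <= N)%N by lia.
rewrite e1 // e2 // scalerA !scalerAr in scal.
have := mulfI (Wpoly_neq0 z l q0 k) scal => {}scal.
have mon (v : nat -> seq C) : Vpoly N v k \is monic by exact: monic_prod_XsubC.
have ratio := congr1 lead_coef scal.
rewrite !lead_coefZ !(monicP (mon _)) !mulr1 in ratio.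
rewrite ratio in scal.
have b0 : with_one_at0 al2 k != 0 by exact: (with_one_at0_neq0 al2_0).
have {scal} := scalerI _ scal.
rewrite -ratio => /(_ b0)/esym; rewrite /Vpoly /level kN; exact: prod_XsubC_eq.
Qed.

Lemma attached_roots_eq (O1 O2 : qflagged C N) (v1 v2 : nat -> seq C) :
  qoper_iso q O1 O2 -> (forall k, (0 < k < N)%N -> perm_eq (v1 k) (v2 k)) ->
  attached_roots q z l kappa O1 v1 -> attached_roots q z l kappa O2 v2.
Proof.
move=> iso vv [O1' [s [al [iso1 Z1 gen al0 e]]]].
exists O1', s, al; split=> //.
  exact: (qoper_iso_trans q0 (qoper_iso_sym q0 iso) iso1).
move=> k kN; rewrite e //; congr (_ *: (_ * _)).
by rewrite /Vpoly /level; case: ifP => // kN'; apply: perm_big; exact: vv.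
Qed.

Lemma bethe_alpha_neq0 u k : (0 < k <= N)%N -> bethe_alpha qh N kappa u k != 0.
Proof.
move=> kN; rewrite mulf_neq0 ?expf_neq0 ?(qh_neq0 q0 qhE) // det_tr.
apply: (@Vandermonde_neq0 _ N) => [|i j iN jN ij]; first by case/andP: kN.
exact: (kappa_distinct kappa_disj).
Qed.

Lemma bethe_solution_oper u :
  bethe_solution q qh N z l kappa u -> bethe_nondegenerate q qh N z u ->
  exists2 O : qflagged C N, nondegenerate_twisted_qoper q z l kappa O &
    attached_roots q z l kappa O (rescale qh u).
Proof.
move=> sol /(bethe_nondegenerate_rescale N z u q0 qhE) nd.
have al0 := bethe_alpha_neq0 u.
have [s eqs Wd] := bethe_qoper q0 qhE q_nroot kappa_neq0 kappa_disj nd al0 sol.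
have att : attached_roots q z l kappa (cyclic_oper q N kappa s) (rescale qh u).
  exists (cyclic_oper q N kappa s), s, (bethe_alpha qh N kappa u); split=> //.
    exact: qoper_iso_refl.
  exact: (cyclic_oper_generating_section q0 kappa_neq0 al0 nd eqs Wd N_gt0).
exists (cyclic_oper q N kappa s) => //; split.
- exact: (cyclic_oper_SL_qoper q0 q_nroot z_neq0 z_disj kappa_neq0 kappa_prod al0 nd eqs Wd).
- exact: cyclic_oper_Z_twisted.
- by exists (rescale qh u).
Qed.

Lemma rescale_surj (v : nat -> seq C) : exists u, rescale qh u = v.
Proof.
exists (fun k => [seq qh ^ (k%:Z - 1) * x | x <- v k]).
apply/funext => k; rewrite /rescale -map_comp -[RHS]map_id; apply: eq_map => x /=.
by rewrite mulrA -expfzDr ?(qh_neq0 q0 qhE) // addrC subrKA subrr expr0z mul1r.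
Qed.

Lemma oper_bethe_solution (O : qflagged C N) : nondegenerate_twisted_qoper q z l kappa O ->
  exists2 u, bethe_solution q qh N z l kappa u /\ bethe_nondegenerate q qh N z u &
    attached_roots q z l kappa O (rescale qh u).
Proof.
move=> [_ _ [v att nd]]; have [u uv] := rescale_surj v; subst v.
exists u => //; split; last by apply/(bethe_nondegenerate_rescale N z u q0 qhE).
have [O' [s [al [_ _ _ al0 e]]]] := att.
exact: (qoper_bethe q0 qhE q_nroot z_neq0 kappa_neq0 kappa_disj nd al0 e).
Qed.

Lemma rescale_perm u u' :
  (forall k, (0 < k < N)%N -> perm_eq (rescale qh u k) (rescale qh u' k)) <->
  same_up_to_perm N u u'.
Proof.
split=> h k kN; last by apply: perm_map; exact: h.
apply: (perm_map_inj _ (h k kN)); apply: mulfI.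
by rewrite expfz_neq0 // (qh_neq0 q0 qhE).
Qed.

Lemma bethe_oper_correspondence :
  one_to_one_correspondence
    (fun u : nat -> seq C =>
       bethe_solution q qh N z l kappa u /\ bethe_nondegenerate q qh N z u)
    (same_up_to_perm N)
    (nondegenerate_twisted_qoper (N := N) q z l kappa)
    (qoper_iso (N := N) q)
    (fun u O => attached_roots q z l kappa O (rescale qh u)).
Proof.
split=> [u [sol nd]|O|u u' O O' _ _ [S _ _] [S' _ _] att att'|u u' O O' _ _ _ _ uu iso att].
- exact: bethe_solution_oper.
- exact: oper_bethe_solution.
- split=> [uu|iso]; last by apply/rescale_perm; exact: (iso_attached_roots iso att att').
  apply: (attached_roots_iso S S' _ att'); apply: attached_roots_eq att.
    exact: qoper_iso_refl.
  by apply/rescale_perm.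
- by apply: attached_roots_eq att => //; apply/rescale_perm.
Qed.

Lemma bethe_iff_oper_equations u : bethe_nondegenerate q qh N z u ->
  bethe_solution q qh N z l kappa u <->
  exists s : nat -> {poly C},
    qoper_equations q N z l kappa (bethe_alpha qh N kappa u) s (rescale qh u).
Proof.
move=> /(bethe_nondegenerate_rescale N z u q0 qhE) nd; have al0 := bethe_alpha_neq0 u.
split=> [sol|[s e]].
  have [s e _] := bethe_qoper q0 qhE q_nroot kappa_neq0 kappa_disj nd al0 sol.
  by exists s.
exact: (qoper_bethe q0 qhE q_nroot z_neq0 kappa_neq0 kappa_disj nd al0 e).
Qed.
End Correspondence.

Theorem theorem4p1 (R : realType) (N L : nat) (q qh : R[i])
    (z : 'I_L -> R[i]) (l : 'I_L -> nat -> nat) (kappa : nat -> R[i])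
    (N_ge2 : (2 <= N)%N)
    (q_neq0 : q != 0)
    (q_nroot : not_root_of_unity q)
    (qhE : qh ^+ 2 = q)
    (z_neq0 : forall m : 'I_L, z m != 0)
    (z_disj : forall m m' : 'I_L, m <> m' -> disjoint_lattices q (z m) (z m'))
    (kappa_neq0 : forall i : nat, (0 < i <= N)%N -> kappa i != 0)
    (kappa_prod : \prod_(1 <= i < N.+1) kappa i = 1)
    (kappa_disj : forall i j : nat, (0 < i <= N)%N -> (0 < j <= N)%N ->
       i <> j -> disjoint_lattices q (kappa i) (kappa j)) :
  one_to_one_correspondence
    (fun u : nat -> seq R[i] =>
       bethe_solution q qh N z l kappa u /\ bethe_nondegenerate q qh N z u)
    (same_up_to_perm N)
    (nondegenerate_twisted_qoper (N := N) q z l kappa)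
    (qoper_iso (N := N) q)
    (fun u O => attached_roots q z l kappa O (rescale qh u))
  /\
  (forall u : nat -> seq R[i], bethe_nondegenerate q qh N z u ->
     (bethe_solution q qh N z l kappa u <->
      exists s : nat -> {poly R[i]},
        qoper_equations q N z l kappa (bethe_alpha qh N kappa u) s
          (rescale qh u))).
Proof.
split=> [|u nd]; first by apply: bethe_oper_correspondence => //; exact: ltnW.
exact: bethe_iff_oper_equations.
Qed.
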